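(* Let $A \subseteq \mathbb{R}^d$ be such that $D(A) = \overline{D}(A)$, and let $k$ be an integer with $0 \le k \le d$. For almost every orthogonal projection $U$ of $\mathbb{R}^d$ with range of dimension $k$, $$\overline{D}(UA) = \min\big(k, \overline{D}(A)\big)$$ and, if $A$ is counting regular and mass regular and $\overline{D}(A) \neq k$, then $\overline{d}^{\,\min(k,\overline{D}(A))}(UA) > 0$ for almost every such $U$.
   Context: A cube in $\mathbb{R}^d$ is a set $C = \prod_{i=1}^d [a_i, a_i+\ell)$ with $a \in \mathbb{R}^d$, $\ell>0$; its side length is $\|C\| = \ell$. For $A \subseteq \mathbb{R}^d$, $\lfloor A \rfloor \subseteq \mathbb{Z}^d$ is the set of elements of $A$ rounded down in each coordinate. For $\alpha \ge 0$, the $\alpha$-counting measure and $\alpha$-mass measure of $A$ are $$d^{\alpha}(A) = \limsup_{\|C\|\to\infty} \frac{|\lfloor A \rfloor \cap C|}{\|C\|^\alpha} := \lim_{\ell\to\infty} \sup_{\|C\| \ge \ell} \frac{|\lfloor A \rfloor \cap C|}{\|C\|^\alpha}, \qquad \overline{d}^{\,\alpha}(A) = \limsup_{\ell\to\infty} \frac{|\lfloor A \rfloor \cap [-\ell,\ell)^d|}{(2\ell)^\alpha},$$ the first supremum being over cubes $C \subseteq \mathbb{R}^d$. The counting dimension and (upper) mass dimension are $D(A) = \inf\{\alpha \ge 0 \mid d^\alpha(A) = 0\}$ and $\overline{D}(A) = \inf\{\alpha \ge 0 \mid \overline{d}^{\,\alpha}(A) = 0\}$. The set $A$ is counting regular if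 $0 < d^{D(A)}(A) < \infty$ and mass regular if $0 < \overline{d}^{\,\overline{D}(A)}(A) < \infty$. Orthogonal projections with range of dimension $k$ are in bijection with the Grassmannian $G(d,k)$ of $k$-dimensional linear subspaces of $\mathbb{R}^d$ via $U \mapsto \mathrm{Range}(U)$. ''Almost every'' is with respect to the unique $O(d)$-invariant Borel probability measure $\gamma_{d,k}$ on $G(d,k)$ under this bijection. *)

(* Defs.v *)
From HB Require Import structures.
From mathcomp Require Import all_boot all_order all_algebra.
From mathcomp Require Import all_classical all_reals all_analysis.

Set Implicit Arguments.
Unset Strict Implicit.
Unset Printing Implicit Defensive.

Import Order.TTheory GRing.Theory Num.Theory.
Import numFieldNormedType.Exports.

Local Open Scope classical_set_scope.
Local Open Scope ring_scope.

(* Vectors of R^d are row vectors, so matrices act on the right: the image of x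
   under the linear map with matrix U is x *m U, and the range of that map is
   the row space of U. *)

Section CountingAndMass.
Variables (R : realType) (d : nat).
Implicit Types (A C : set 'rV[R]_d) (a : 'rV[R]_d) (l alpha : R).

Definition cube a l : set 'rV[R]_d :=
  [set x | forall i, a 0 i <= x 0 i < a 0 i + l].

Definition floor_vec (x : 'rV[R]_d) : 'rV[R]_d :=
  map_mx (fun r : R => (Num.floor r)%:~R) x.

(* Z^d is seen inside R^d *)
Definition floor_set A : set 'rV[R]_d := floor_vec @` A.

(* |floor(A) `&` C| / l^alpha, where l is the side length of the cube C *)
Definition density alpha A C l : \bar R :=
  (counting (floor_set A `&` C) / (l `^ alpha)%:E)%E.

(* The function of l under the limit is nonincreasing, so the limit exists
   in \bar R. *)
Definition counting_measure alpha A : \bar R :=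
  lim (ereal_sup [set density alpha A (cube p.1 p.2) p.2
                 | p in [set p : 'rV[R]_d * R | 0 < p.2 /\ l <= p.2]]
       @[l --> +oo]).

Definition mass_measure alpha A : \bar R :=
  limf_esup (fun l : R => density alpha A (cube (const_mx (- l)) (2 * l)) (2 * l))
            (pinfty_nbhs R).

(* In both definitions the set is bounded below by 0 and contains every
   alpha > d, so its real infimum is a genuine one. *)
Definition counting_dim A : R :=
  inf [set alpha : R | 0 <= alpha /\ counting_measure alpha A = 0%E].

Definition mass_dim A : R :=
  inf [set alpha : R | 0 <= alpha /\ mass_measure alpha A = 0%E].

Definition counting_regular A : Prop :=
  (0 < counting_measure (counting_dim A) A < +oo)%E.

Definition mass_regular A : Prop :=
  (0 < mass_measure (mass_dim A) A < +oo)%E.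

End CountingAndMass.

Definition is_oproj (R : realType) (d k : nat) (U : 'M[R]_d) : bool :=
  [&& U^T == U, U *m U == U & \rank U == k].

(* The orthogonal projections of R^d with range of dimension k.  By
   oproj_range_ex and oproj_range_inj below, U |-> Range(U) is a bijection onto
   the Grassmannian G(d, k), and oproj carries the structure of G(d, k) through
   it: the topology is that of the projection matrices, i.e. of the usual metric
   |P_V - P_W| on G(d, k), and by range_oproj_act the action of O(d) on
   subspaces becomes conjugation. *)
Record oproj (R : realType) (d : nat) (k : 'I_d.+1) := OProj {
  oproj_mx :> 'M[R]_d ;
  oprojP : is_oproj k oproj_mx
}.
Arguments OProj {R d k}.

HB.instance Definition _ (R : realType) (d : nat) (k : 'I_d.+1) :=
  [isSub for @oproj_mx R d k].
HB.instance Definition _ (R : realType) (d : nat) (k : 'I_d.+1) :=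
  [Choice of oproj R k by <:].

Section OProj.
Variables (R : realType) (d : nat) (k : 'I_d.+1).

Lemma is_oproj_pid : is_oproj k (pid_mx k : 'M[R]_d).
Proof.
have kd : (k <= d)%N by rewrite -ltnS.
by rewrite /is_oproj tr_pid_mx eqxx pid_mx_id // eqxx rank_pid_mx ?kd /=.
Qed.

HB.instance Definition _ := isPointed.Build (oproj R k) (OProj _ is_oproj_pid).
HB.instance Definition _ := Topological.copy (oproj R k)
  (initial_topology (@oproj_mx R d k)).

Lemma is_oproj_act (g : 'M[R]_d) (gO : g *m g^T = 1%:M) (U : oproj R k) :
  is_oproj k (g^T *m U *m g).
Proof.
have gU : g \in unitmx by case/mulmx1_unit: gO.
have gTU : g^T \in unitmx by rewrite unitmx_tr.
case/and3P: (oprojP U) => /eqP UT /eqP UU /eqP rU.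
apply/and3P; split; apply/eqP.
- by rewrite !trmx_mul trmxK UT mulmxA.
- rewrite -!mulmxA; congr (_ *m _).
  by rewrite (mulmxA g) gO mul1mx mulmxA UU.
- rewrite mxrankMfree ?row_free_unit //.
  by rewrite eqmxMfull // row_full_unit.
Qed.

Definition oproj_act (g : 'M[R]_d) (gO : g *m g^T = 1%:M) (U : oproj R k) :
  oproj R k := OProj _ (is_oproj_act gO U).

Lemma range_oproj_act (g : 'M[R]_d) (gO : g *m g^T = 1%:M) (U : oproj R k) :
  (oproj_act gO U :=: U *m g)%MS.
Proof.
have gU : g \in unitmx by case/mulmx1_unit: gO.
rewrite /= -mulmxA; apply: eqmxMfull.
by rewrite row_full_unit unitmx_tr.
Qed.

Lemma oproj_range_inj (U V : oproj R k) : (U == V)%MS -> U = V.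
Proof.
case/andP=> /submxP[D UD] /submxP[E VE]; apply: val_inj => /=.
case/and3P: (oprojP U) => /eqP UT /eqP UU _.
case/and3P: (oprojP V) => /eqP VT /eqP VV _.
have UV : U *m V = oproj_mx U by rewrite {1}UD -mulmxA VV -UD.
have VU : V *m U = oproj_mx V by rewrite {1}VE -mulmxA UU -VE.
by rewrite -{1}UT -UV trmx_mul VT UT.
Qed.

Lemma oproj_range_ex (V : 'M[R]_d) : \rank V = k ->
  exists U : oproj R k, (U :=: V)%MS.
Proof.
move=> rV; pose B := row_base V; pose S := B *m B^T.
have Bfree : row_free B := row_base_free V.
have ST : S^T = S by rewrite trmx_mul trmxK.
have SU : S \in unitmx.
  rewrite -row_free_unit -kermx_eq0; apply/eqP/row_matrixP => i.
  rewrite row0; set x := row i _.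
  have xS : x *m S = 0 by rewrite -row_mul mulmx_ker row0.
  have xB0 : x *m B = 0.
    have : (x *m B) *m (x *m B)^T = 0.
      by rewrite trmx_mul mulmxA -(mulmxA x) xS mul0mx.
    move=> /matrixP/(_ 0 0); rewrite [LHS]mxE [RHS]mxE => s0.
    apply/rowP => j; rewrite [RHS]mxE; apply/eqP.
    have h := @psumr_eq0P _ _ predT (fun j => (x *m B) 0 j ^+ 2)
      (fun j _ => sqr_ge0 _).
    rewrite -sqrf_eq0; apply/eqP; apply: h => //.
    by rewrite -[RHS]s0; apply: eq_bigr => l _; rewrite [_^T _ _]mxE expr2.
  by apply/eqP; rewrite -(mulmx_free_eq0 _ Bfree) xB0.
pose U := B^T *m invmx S *m B.
have BU : B *m U = B by rewrite /U !mulmxA mulmxV // mul1mx.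
have rU : (U :=: V)%MS.
  apply/eqmxP/andP; split.
    by rewrite (submx_trans (submxMl _ _)) // eq_row_base.
  by rewrite -(eq_row_base V) -/B -{1}BU submxMl.
have UP : is_oproj k U.
  apply/and3P; split; apply/eqP.
  - by rewrite /U (trmx_mul (B^T *m _) B) (trmx_mul B^T) trmxK trmx_inv ST mulmxA.
  - have <- : B^T *m invmx S *m (B *m U) = U *m U by rewrite mulmxA.
    by rewrite BU.
  - by rewrite rU.
by exists (OProj U UP).
Qed.

(* The Borel probability measures satisfying this are the O(d)-invariant ones on
   G(d, k), of which there is exactly one, gamma_{d,k}. *)
Definition Od_invariant
    (gamma : probability (g_sigma_algebraType (@open (oproj R k))) R) : Prop :=
  forall (g : 'M[R]_d) (gO : g *m g^T = 1%:M)
    (B : set (g_sigma_algebraType (@open (oproj R k)))),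
    measurable B -> gamma (oproj_act gO @^-1` B) = gamma B.

End OProj.

Definition proj_image (R : realType) (d : nat) (k : 'I_d.+1) (U : oproj R k)
    (A : set 'rV[R]_d) : set 'rV[R]_d :=
  [set x *m U | x in A].

(* Main.v *)
Require Import Defs.
From mathcomp Require Import all_boot all_order all_algebra.
From mathcomp Require Import finmap.
From mathcomp Require Import all_classical all_reals all_analysis.
From mathcomp Require Import measurable_realfun.
From mathcomp Require Import ring lra zify.
Import Order.TTheory GRing.Theory Num.Theory.
Import numFieldNormedType.Exports.
Local Open Scope classical_set_scope.
Local Open Scope ring_scope.

Set Implicit Arguments.
Unset Strict Implicit.
Unset Printing Implicit Defensive.

(** Write [A^] for the set of floors of the points of [A], [D] for the common
    dimension of [A], and [k] for the rank of the random projection [U].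

    The only property of the invariant law that matters is a small ball estimate
    ([small_ball]): a vector [z] of length at least [n] satisfies [|z U| <= c] with
    probability at most [C / n ^ k].  Reflections act transitively on spheres, so
    this probability is at most the average of the corresponding ones over the
    lattice points of the box [1, n]^d; for a fixed [U], the lattice points counted
    there lie near the kernel of [U], whose dimension is [d - k], so they are a
    proportion of order [n ^ (- k)] of the box ([lattice_near_subspace]).

    Suppose that every cube of side [l >= 1] contains at most order [l ^ sigma]
    points of [A^].  Summing the small ball estimate over dyadic scales around a
    point [x] ([potential_le]), the expected number of [y] in [A^] at distance at
    most [L] of [x] with [|(y - x) U| <= c] is at most of order the geometric sum of
    the [2 ^ (j (sigma - k))] for [2 ^ j <= L].

    Lower bound ([ae_mass_growth_proj]).  Take a box of side [l] with at least
    order [l ^ alpha] points of [A^].  By the previous estimate the expected number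
    of pairs that [U] brings within bounded distance is at most the number of points
    times [l ^ max (0, sigma - k)].  By Fatou's lemma, almost surely this holds for
    infinitely many of the boxes, up to a constant depending on [U]; by the
    Cauchy-Schwarz inequality, the image of such a box then has at least order
    [l ^ (alpha - max (0, sigma - k))] distinct floors.  With [alpha] and [sigma]
    near [D] this is the bound of the dimension by [min (k, D)] from below; with
    [alpha = sigma = D], which the regularity of [A] permits, it is the positivity
    of the mass measure.  The case [sigma = k] is excluded because the geometric sum
    is then logarithmic.

    Upper bound.  The dimension is at most [k] because the image lies in a
    subspace of dimension [k] ([mass_bound_proj_dim]).  It is at most [D] when
    [D < k] because points far away rarely project into a given box: for
    [D < sigma < beta < k] the series over [m] of [2 ^ (- beta m)] times the number
    of [x] in [A^] with [|x U| <= c 2 ^ m] has finite expectation ([ae_few_short]). *)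

(** * Fibres of maps on finite sequences *)

Lemma size_le_fibers (T T' : eqType) (s : seq T) (f : T -> T') (N : nat) :
  (forall y, (count (fun x => f x == y) s <= N)%N) ->
  (size s <= size (undup (map f s)) * N)%N.
Proof.
move=> fN; set u := undup _.
have -> : size s = (\sum_(y <- u) count (fun x => f x == y) s)%N.
  under eq_bigr do rewrite -sum1_count big_mkcond /=.
  rewrite exchange_big /= -sum1_size big_seq [RHS]big_seq.
  apply: eq_bigr => x xs; rewrite -big_mkcond sum1_count.
  rewrite (@eq_count _ _ (pred1 (f x))); last by move=> y; rewrite /= eq_sym.
  by rewrite count_uniq_mem ?undup_uniq // mem_undup map_f.
rewrite -sum1_size big_distrl /=; apply: leq_sum => y _; rewrite mul1n; exact: fN.
Qed.

(** Cauchy-Schwarz inequality for the sizes of the fibres of [f]: their squares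
    add up to the number of pairs with the same image. *)
Lemma sqr_size_le_pairs (R : realFieldType) (T T' : eqType) (s : seq T)
    (f : T -> T') :
  (size s)%:R ^+ 2 <= (size (undup (map f s)))%:R *
    (\sum_(x <- s) \sum_(y <- s) (f x == f y)%:R) :> R.
Proof.
set u := undup _; set Q := \sum_(x <- s) _.
pose c y : R := \sum_(x <- s) (f x == y)%:R.
have inj x (g : T' -> R) : x \in s -> \sum_(y <- u) (f x == y)%:R * g y = g (f x).
  move=> xs; have fxu : f x \in u by rewrite mem_undup map_f.
  rewrite (bigD1_seq _ fxu) ?undup_uniq //= eqxx mul1r big1 ?addr0 // => y yfx.
  by rewrite eq_sym (negbTE yfx) mul0r.
have sumc : \sum_(y <- u) c y = (size s)%:R.
  rewrite exchange_big /= -sum1_size natr_sum big_seq [RHS]big_seq.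
  apply: eq_bigr => x xs; rewrite -[RHS](inj x (fun=> 1)) //.
  by apply: eq_bigr => y _; rewrite mulr1.
have sumc2 : \sum_(y <- u) c y ^+ 2 = Q.
  under eq_bigr do rewrite expr2 {1}/c mulr_suml.
  rewrite exchange_big /= /Q big_seq [RHS]big_seq; apply: eq_bigr => x xs.
  rewrite inj //; apply: eq_bigr => y _; by rewrite eq_sym.
set N : R := (size s)%:R; set M : R := (size u)%:R.
have [M0|M0] := eqVneq M 0.
  have u0 : u = [::] by apply/eqP; rewrite -size_eq0 -(eqr_nat R) -/M M0.
  have: N = 0 by rewrite /N -sumc u0 big_nil.
  by move=> ->; rewrite M0 mul0r expr0n.
have Mp : 0 < M by rewrite lt_def M0 ler0n.
(* the variance of the fibre sizes is nonnegative *)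
have : 0 <= \sum_(y <- u) (c y - N / M) ^+ 2 by apply: sumr_ge0 => y _; apply: sqr_ge0.
under eq_bigr do rewrite sqrrB.
rewrite big_split /= sumrB sumc2 big_const_seq count_predT iter_addr_0.
rewrite -mulr_natl -/M sumrMnl -mulr_suml sumc -/N => h.
rewrite -subr_ge0; have -> : M * Q - N ^+ 2 = M * (Q - N * (N / M) *+ 2 + M * (N / M) ^+ 2).
  by field.
by rewrite mulr_ge0 // ltW.
Qed.

(** * Sums of indicators of random events *)

Section Expectation.
Context (disp : measure_display) (T : measurableType disp) (R : realType)
  (P : probability T R).

Lemma integral_sum_indic (I : Type) (s : seq I) (w : I -> R) (E : I -> set T) :
  (forall i, 0 <= w i) -> (forall i, measurable (E i)) ->
  (\int[P]_x (\sum_(i <- s) w i * \1_(E i) x)%:E =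
   (\sum_(i <- s) w i * fine (P (E i)))%:E)%E.
Proof.
move=> w0 mE.
under eq_integral do rewrite -sumEFin.
rewrite ge0_integral_sum //; last by move=> i x _; rewrite lee_fin mulr_ge0.
  rewrite -sumEFin; apply: eq_bigr => i _.
  under eq_integral do rewrite EFinM.
  rewrite ge0_integralZl_EFin //; last first.
    by apply/measurable_EFinP; exact: measurable_indic.
  by rewrite integral_indic // setIT EFinM fineK // fin_num_measure.
by move=> i; apply/measurable_EFinP; apply: measurable_funM => //; exact: measurable_indic.
Qed.

(** The left-hand side is the expected number of events that occur. *)
Lemma sum_prob_le (I : Type) (s : seq I) (E : I -> set T) (M : R) :
  (forall i, measurable (E i)) ->
  (forall x, \sum_(i <- s) \1_(E i) x <= M) -> \sum_(i <- s) fine (P (E i)) <= M.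
Proof.
move=> mE EM.
have := @integral_sum_indic I s (fun=> 1) E (fun=> ler01) mE.
under [in X in (_ = X)%E -> _]eq_bigr do rewrite mul1r.
rewrite -lee_fin => <-.
rewrite (@le_trans _ _ (\int[P]_x (M%:E))%E) //; last first.
  rewrite integral_cst // (_ : (_ * _)%E = M%:E) // -[RHS]mule1.
  by congr (_ * _)%E; exact: probability_setT.
apply: ge0_le_integral => //.
- by move=> x _; rewrite lee_fin; apply: sumr_ge0 => i _; rewrite mul1r.
- apply/measurable_EFinP; apply: measurable_sum => i.
  by apply: measurable_funM => //; exact: measurable_indic.
- by move=> x _; rewrite lee_fin; under eq_bigr do rewrite mul1r; exact: EM.
Qed.

(** By Fatou's lemma the inferior limit of the sums has finite integral. *)
Lemma ae_bounded_infinitely_often (I : Type) (s : nat -> seq I)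
    (w : nat -> I -> R) (E : nat -> I -> set T) (K : R) :
  (forall n i, 0 <= w n i) -> (forall n i, measurable (E n i)) ->
  (forall n, \sum_(i <- s n) w n i * fine (P (E n i)) <= K) ->
  {ae P, forall x, exists t, forall n0, exists2 n, (n0 <= n)%N &
     \sum_(i <- s n) w n i * \1_(E n i) x <= t}.
Proof.
move=> w0 mE EK.
pose f n x := (\sum_(i <- s n) w n i * \1_(E n i) x)%:E.
have f0 n x : setT x -> (0 <= f n x)%E.
  by move=> _; rewrite lee_fin; apply: sumr_ge0 => i _; rewrite mulr_ge0.
have mf n : measurable_fun setT (f n).
  apply/measurable_EFinP; apply: measurable_sum => i.
  by apply: measurable_funM => //; exact: measurable_indic.
have ml : measurable_fun setT (fun x => limn_einf (f ^~ x)).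
  rewrite /limn_einf; apply: measurableT_comp => //; apply: measurable_fun_limn_esup.
  by move=> n; apply: measurableT_comp.
have l0 x : (0 <= limn_einf (f ^~ x))%E.
  rewrite limn_einf_lim; apply: lime_ge; first exact: is_cvg_einfs.
  by apply: nearW => n; apply: le_ereal_inf_tmp => _ [m /= nm <-]; exact: f0.
have lK : (\int[P]_x limn_einf (f ^~ x) <= K%:E)%E.
  apply: (le_trans (fatou P measurableT mf f0)).
  rewrite limn_einf_lim; apply: lime_le; first exact: is_cvg_einfs.
  apply: nearW => n; apply: ereal_inf_le; exists (\int[P]_x f n x)%E.
    by exists n => /=.
  by rewrite integral_sum_indic // lee_fin.
have int : P.-integrable setT (fun x => limn_einf (f ^~ x)).
  apply/integrableP; split => //.
  under eq_integral do rewrite gee0_abs //.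
  exact: le_lt_trans lK (ltry _).
apply: filterS (integrable_ae measurableT int) => x /(_ Logic.I).
have := l0 x; case El : (limn_einf (f ^~ x)) => [l| |] // _ _.
exists (l + 1) => n0.
have : (einfs (f ^~ x) n0 < (l + 1)%:E)%E.
  apply: (@le_lt_trans _ _ l%:E); last by rewrite lte_fin ltrDl.
  rewrite -El limn_einf_lim; apply: lime_ge; first exact: is_cvg_einfs.
  by exists n0 => // m /= ?; exact: nondecreasing_einfs.
move=> /ereal_inf_lt [_ [n /= n0n <-]].
by rewrite lte_fin => /ltW; exists n.
Qed.

End Expectation.

(** * Euclidean geometry of projections *)

Section Euclid.
Variable R : realType.

(** The squared Euclidean norm. *)
Definition sqn n (x : 'rV[R]_n) : R := \sum_i x 0 i ^+ 2.

Lemma sqnE n (x : 'rV[R]_n) : sqn x = (x *m x^T) 0 0.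
Proof. by rewrite mxE; apply: eq_bigr => i _; rewrite mxE expr2. Qed.

Lemma sqn_ge0 n (x : 'rV[R]_n) : 0 <= sqn x.
Proof. by apply: sumr_ge0 => i _; apply: sqr_ge0. Qed.

Lemma sqnZ n a (x : 'rV[R]_n) : sqn (a *: x) = a ^+ 2 * sqn x.
Proof. by rewrite /sqn mulr_sumr; apply: eq_bigr => i _; rewrite mxE exprMn. Qed.

Lemma sqnN n (x : 'rV[R]_n) : sqn (- x) = sqn x.
Proof. by rewrite -scaleN1r sqnZ sqrrN expr1n mul1r. Qed.

Lemma sqr_coord_le_sqn n (x : 'rV[R]_n) i : x 0 i ^+ 2 <= sqn x.
Proof. by rewrite /sqn (bigD1 i) //= lerDl; apply: sumr_ge0 => j _; apply: sqr_ge0. Qed.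

Lemma sqn_eq0 n (x : 'rV[R]_n) : sqn x = 0 -> x = 0.
Proof.
move=> x0; apply/rowP => i; rewrite mxE; apply/eqP; rewrite -sqrf_eq0.
by rewrite eq_le sqr_ge0 -x0 sqr_coord_le_sqn.
Qed.

Lemma sqnD_le n (x y : 'rV[R]_n) : sqn (x + y) <= 2 * (sqn x + sqn y).
Proof.
rewrite /sqn -big_split mulr_sumr; apply: ler_sum => i _ /=; rewrite mxE.
have := sqr_ge0 (x 0 i - y 0 i); nra.
Qed.

Lemma sqn_le_coord n (x : 'rV[R]_n) M :
  (forall i, `|x 0 i| <= M) -> sqn x <= n%:R * M ^+ 2.
Proof.
move=> xM; rewrite -[X in X%:R](card_ord n) -sum1_card natr_sum mulr_suml.
apply: ler_sum => i _; rewrite mul1r -real_normK ?num_real //.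
by rewrite lerXn2r ?nnegrE ?(le_trans _ (xM i)).
Qed.

Lemma sqn_pythagoras n (V : 'M[R]_n) (x : 'rV[R]_n) : V^T = V -> V *m V = V ->
  sqn x = sqn (x *m V) + sqn (x - x *m V).
Proof.
move=> VT VV; set y := x *m V; set z := x - y.
have yz : y *m z^T = 0.
  rewrite /z linearB /= mulmxBr {2}/y trmx_mul VT /y !mulmxA.
  by rewrite -[X in _ - X *m _]mulmxA VV subrr.
have zy : z *m y^T = 0 by rewrite -[LHS]trmxK trmx_mul trmxK yz trmx0.
have -> : x = y + z by rewrite /z addrC subrK.
rewrite !sqnE linearD /= mulmxDl !mulmxDr yz zy addr0 add0r.
by rewrite mxE.
Qed.

Lemma sqn_proj_le n (V : 'M[R]_n) (x : 'rV[R]_n) : V^T = V -> V *m V = V ->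
  sqn (x *m V) <= sqn x.
Proof. by move=> VT VV; rewrite (sqn_pythagoras x VT VV) lerDl sqn_ge0. Qed.

(** Splitting off one unit vector of the range at a time produces an
    orthonormal basis, written as the rows of [B]. *)
Lemma oproj_gram n m (V : 'M[R]_n) : V^T = V -> V *m V = V -> \rank V = m ->
  exists B : 'M[R]_(m, n), V = B^T *m B.
Proof.
elim: m V => [|m IH] V VT VV rV.
  by exists 0; rewrite mulmx0; apply/eqP; rewrite -mxrank_eq0 rV.
have [i vi0] : exists i, row i V != 0.
  apply: contrapT => /forallNP h; suff V0 : V = 0 by rewrite V0 mxrank0 in rV.
  by apply/row_matrixP => i; rewrite row0; apply/eqP; apply/negP => /negP/(h i).
set u := row i V.
have uV : u *m V = u by rewrite /u -row_mul VV.
have up : 0 < sqn u.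
  rewrite lt_def sqn_ge0 andbT; apply: contra vi0 => /eqP/sqn_eq0.
  by rewrite -/u => ->.
pose v := (Num.sqrt (sqn u))^-1 *: u.
have vV : v *m V = v by rewrite /v -scalemxAl uV.
have vv : v *m v^T = 1%:M.
  apply/rowP => j; rewrite !ord1 -sqnE sqnZ exprVn sqr_sqrtr ?ltW //.
  by rewrite mulVf ?gt_eqF // mxE eqxx.
have Vv : V *m v^T = v^T by rewrite -[in LHS]VT -trmx_mul vV.
pose W := V - v^T *m v.
have WT : W^T = W by rewrite /W linearB /= trmx_mul trmxK VT.
have WW : W *m W = W.
  rewrite /W mulmxBl !mulmxBr VV mulmxA Vv -!mulmxA vV (mulmxA v) vv mul1mx.
  by rewrite subrr subr0.
have WV : W *m V = W by rewrite /W mulmxBl VV -mulmxA vV.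
have vW : v *m W = 0 by rewrite /W mulmxBr vV mulmxA vv mul1mx subrr.
have v0 : v != 0.
  apply/eqP => v0; move: vv; rewrite v0 mul0mx => /matrixP/(_ 0 0).
  by rewrite !mxE eqxx => /eqP; rewrite eq_sym oner_eq0.
have VE : V = v^T *m v + W by rewrite /W addrC subrK.
have rW : \rank W = m.
  apply/eqP; rewrite eqn_leq; apply/andP; split.
    rewrite -ltnS -rV; apply: rank_ltmx; rewrite ltmxE -{1}WV submxMl /=.
    apply: contraNN v0 => /submxP[D VD].
    have : v *m V *m W = v by rewrite VD -!mulmxA WW -VD vV.
    by rewrite vV vW => <-.
  rewrite -ltnS -rV {1}VE; apply: (leq_trans (mxrank_add _ _)).
  rewrite -[X in (_ <= X)%N]add1n leq_add2r.
  by apply: leq_trans (mxrankM_maxr _ _) _; exact: rank_leq_row.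
have [B WB] := IH W WT WW rW.
have VB : V = (col_mx v B)^T *m col_mx v B.
  by rewrite tr_col_mx mul_row_col -WB -VE.
by exists (col_mx v B).
Qed.
End Euclid.

(** * Lattice points *)

Section Lattice.
Variable R : realType.

(** The subgroup Z^n of R^n. *)
Definition lattice n : set 'rV[R]_n := [set x | forall i, x 0 i \is a Num.int].

Lemma floor_vec_lattice n (x : 'rV[R]_n) : lattice (floor_vec x).
Proof. by move=> i; rewrite mxE rpred_int. Qed.

Lemma floor_set_lattice n (A : set 'rV[R]_n) : Defs.floor_set A `<=` @lattice n.
Proof. by move=> _ [x _ <-]; exact: floor_vec_lattice. Qed.

Lemma floor_coord (r : R) : (Num.floor r)%:~R <= r < (Num.floor r)%:~R + 1.
Proof. by rewrite -[X in _ + X]/(1%:~R) -intrD floor_itv ?num_real. Qed.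

Lemma floor_vec_close n (x : 'rV[R]_n) i : `|floor_vec x 0 i - x 0 i| <= 1.
Proof. rewrite mxE ler_norml; have := floor_coord (x 0 i); lra. Qed.

Lemma sqn_floor n (x : 'rV[R]_n) : sqn (floor_vec x - x) <= n%:R.
Proof.
rewrite -[leRHS]mulr1 -[X in _ * X](expr1n _ 2); apply: sqn_le_coord => i.
by rewrite mxE [X in _ + X]mxE floor_vec_close.
Qed.

(** A grid that contains the lattice points of the closed box of centre [a] and
    half side [r]. *)
Definition lattice_box n (a : 'rV[R]_n) (r : nat) : seq 'rV[R]_n :=
  [seq \row_i ((Num.ceil (a 0 i - r%:R))%:~R + (f i : nat)%:R)
     | f : {ffun 'I_n -> 'I_(2 * r).+1}].

Lemma size_lattice_box n (a : 'rV[R]_n) r :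
  size (lattice_box a r) = ((2 * r).+1 ^ n)%N.
Proof. by rewrite size_map -cardT card_ffun !card_ord. Qed.

Lemma mem_lattice_box n (a x : 'rV[R]_n) (r : nat) : lattice x ->
  (forall i, `|x 0 i - a 0 i| <= r%:R) -> x \in lattice_box a r.
Proof.
move=> xZ xa.
have xE i : exists m : 'I_(2 * r).+1, x 0 i = (Num.ceil (a 0 i - r%:R))%:~R + (m : nat)%:R.
  have /intrP[z xz] := xZ i; set c := Num.ceil _.
  have := xa i; rewrite ler_norml xz => /andP[h1 h2].
  have cz : c <= z by rewrite ceil_le_int; lra.
  have zc : (z - c < (2 * r).+1%:Z)%R.
    rewrite -(ltr_int R) rmorphB /= -pmulrn -natr1 natrM.
    have : a 0 i - r%:R <= c%:~R by exact: ceil_ge.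
    lra.
  have : (`|z - c|%N < (2 * r).+1)%N by rewrite -ltz_nat gez0_abs // subr_ge0.
  move=> lt; exists (Ordinal lt) => /=.
  by rewrite pmulrn gez0_abs ?subr_ge0 // rmorphB /= addrC subrK.
have [f xf] := choice xE; apply/fintype.imageP.
by exists (finfun f) => //; apply/rowP => i; rewrite mxE ffunE xf.
Qed.

Lemma lattice_near_le n (a : 'rV[R]_n) (r : nat) (s : seq 'rV[R]_n) : uniq s ->
  {in s, forall x, lattice x /\ forall i, `|x 0 i - a 0 i| <= r%:R} ->
  (size s <= (2 * r).+1 ^ n)%N.
Proof.
move=> us sP; rewrite -(size_lattice_box a); apply: uniq_leq_size => // x xs.
by apply: mem_lattice_box; case: (sP _ xs).
Qed.

Lemma lattice_near_finite n (a : 'rV[R]_n) (r : nat) (S : set 'rV[R]_n) :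
  (forall x, S x -> lattice x /\ forall i, `|x 0 i - a 0 i| <= r%:R) ->
  finite_set S.
Proof.
move=> SP; apply: (@sub_finite_set _ _ [set` lattice_box a r]) => // x Sx.
by apply: mem_lattice_box; case: (SP _ Sx).
Qed.

(** Rounding the coordinates in an orthonormal basis of the range takes at most
    order [rho ^ m] values, and two points with the same value are at bounded
    distance. *)
Lemma lattice_near_subspace n (c : nat) : exists C : nat,
  forall (V : 'M[R]_n) (rho : nat) (s : seq 'rV[R]_n),
  V^T = V -> V *m V = V -> (0 < rho)%N -> uniq s ->
  {in s, forall x, [/\ lattice x, sqn x <= rho%:R ^+ 2 &
                      sqn (x - x *m V) <= c%:R]} ->
  (size s <= C * rho ^ \rank V)%N.
Proof.
exists ((2 * (n + 4 * c)).+1 ^ n * 5 ^ n)%N.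
move=> V rho s VT VV rho0 us sP; set m := \rank V.
have [B VB] := oproj_gram VT VV (erefl m).
have BV p (x : 'rV[R]_n) : p = x *m V -> sqn p = sqn (x *m B^T).
  move=> ->; rewrite !sqnE trmx_mul VT mulmxA -(mulmxA x) VV {1}VB.
  by rewrite trmx_mul trmxK !mulmxA.
pose f (x : 'rV[R]_n) : 'rV[R]_m := floor_vec (x *m B^T).
have dist (x y : 'rV[R]_n) : x \in s -> y \in s -> f x = f y ->
    sqn (x - y) <= (n + 4 * c)%:R ^+ 2.
  move=> /sP[_ _ xc] /sP[_ _ yc] fxy.
  rewrite (sqn_pythagoras _ VT VV) (@le_trans _ _ (n + 4 * c)%:R) //; last first.
    by rewrite -natrX ler_nat; case: (n + 4 * c)%N => // p; rewrite -mulnn leq_pmulr.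
  rewrite natrD; apply: lerD.
    rewrite (BV _ (x - y)) // (@le_trans _ _ (m%:R * 1 ^+ 2)) //; last first.
      by rewrite expr1n mulr1 ler_nat rank_leq_row.
    apply: sqn_le_coord => i; rewrite mulmxBl !mxE.
    move/rowP: fxy => /(_ i); rewrite !mxE.
    set p := \sum_j _; set q := \sum_j _ => pq.
    have := floor_coord p; have := floor_coord q; rewrite -pq ler_norml; lra.
  have -> : x - y - (x - y) *m V = (x - x *m V) + - (y - y *m V).
    by rewrite mulmxBl !opprB addrACA [RHS]addrACA; congr (_ + _); exact: addrC.
  rewrite (le_trans (sqnD_le _ _)) // sqnN natrM; lra.
have small (r : nat) (t : R) : t ^+ 2 <= r%:R ^+ 2 -> `|t| <= r%:R.
  move=> tr; rewrite -[leRHS]ger0_norm // -(ler_sqr (x := `|t|)) ?nnegrE //.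
  by rewrite !real_normK ?num_real.
set N := ((2 * (n + 4 * c)).+1 ^ n)%N.
have fibre y : (count (fun x => f x == y) s <= N)%N.
  rewrite -size_filter; set g := seq.filter _ s.
  have gP x : x \in g -> x \in s /\ f x = y.
    by rewrite mem_filter => /andP[/eqP].
  case Eg : g => [//|x0 t]; rewrite -Eg.
  have [x0s fx0] : x0 \in s /\ f x0 = y by apply: gP; rewrite Eg mem_head.
  apply: (@lattice_near_le _ x0); first exact: filter_uniq.
  move=> x /gP[xs fx]; split; first by case: (sP _ xs).
  move=> i; apply: small; apply: le_trans (dist x x0 xs x0s _); last by rewrite fx fx0.
  by have := sqr_coord_le_sqn (x - x0) i; rewrite !mxE.
rewrite (leq_trans (size_le_fibers fibre)) // mulnC -mulnA leq_mul2l.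
apply/orP; right.
have leX a b p : (a <= b)%N -> (a ^ p <= b ^ p)%N.
  by case: p => // p; rewrite leq_exp2r.
apply: (@leq_trans ((2 * rho.+1).+1 ^ m)%N); last first.
  apply: (@leq_trans ((5 * rho) ^ m)%N); first by apply: leX; lia.
  by rewrite expnMn leq_mul2r leq_pexp2l ?orbT // rank_leq_row.
apply: (@lattice_near_le _ 0); first exact: undup_uniq.
move=> y; rewrite mem_undup => /mapP[x xs ->]; split; first exact: floor_vec_lattice.
have [_ xr _] := sP _ xs.
move=> i; rewrite [X in _ - X]mxE subr0.
have : `|(x *m B^T) 0 i| <= rho%:R.
  apply: small; apply: le_trans (sqr_coord_le_sqn _ i) _.
  by rewrite -(BV _ x (erefl _)) (le_trans (sqn_proj_le _ VT VV)).
have := floor_vec_close (x *m B^T) i; rewrite -natr1 !ler_norml; lra.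
Qed.
End Lattice.

(** * Small ball probabilities *)

Lemma continuous_big_sum (R : realType) (T : topologicalType) (I : Type) (s : seq I)
    (f : I -> T -> R) : (forall i, continuous (f i)) ->
  continuous (fun x => \sum_(i <- s) f i x).
Proof.
move=> fc x; elim: s => [|i s IH].
  under eq_fun do rewrite big_nil; exact: cvg_cst.
by under eq_fun do rewrite big_cons; apply: cvgD => //; exact: fc.
Qed.

(** The reflection in the hyperplane orthogonal to [x - y] exchanges [x] and
    [y]. *)
Lemma reflection_ex (R : realType) n (x y : 'rV[R]_n) : sqn x = sqn y ->
  exists2 g : 'M[R]_n, g *m g^T = 1%:M & x *m g = y.
Proof.
move=> xy; have [->|nxy] := eqVneq x y.
  by exists 1%:M; rewrite ?trmx1 mulmx1.
pose w := x - y; pose g : 'M[R]_n := 1%:M - (2 / sqn w) *: (w^T *m w).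
have w0 : sqn w != 0.
  by apply: contraNneq nxy => /sqn_eq0 /eqP; rewrite subr_eq0.
have gT : g^T = g by rewrite /g linearB linearZ /= trmx1 trmx_mul trmxK.
have ww : w *m w^T = (sqn w)%:M by rewrite [LHS]mx11_scalar -sqnE.
(* equal lengths make x half way between the hyperplane and its translate by w *)
have xw : x *m w^T = (sqn w / 2)%:M.
  have yx : y *m x^T = x *m y^T.
    by rewrite -[LHS]trmxK trmx_mul trmxK [RHS]mx11_scalar [X in X^T]mx11_scalar tr_scalar_mx.
  rewrite [LHS]mx11_scalar; congr _%:M.
  rewrite sqnE /w linearB /= mulmxBl !mulmxBr yx.
  move: xy; rewrite !sqnE.
  have mB (p q : 'M[R]_1) : (p - q) 0 0 = p 0 0 - q 0 0 by rewrite !mxE.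
  rewrite !mB; lra.
exists g.
  set c := 2 / sqn w in g gT *.
  have gg : (w^T *m w) *m (w^T *m w) = sqn w *: (w^T *m w).
    by rewrite mulmxA -(mulmxA w^T) ww mul_mx_scalar -scalemxAl.
  rewrite gT /g; move: (w^T *m w) gg => M gg.
  rewrite mulmxBl !mulmxBr !mul1mx mulmx1 -scalemxAr -scalemxAl gg !scalerA.
  have -> : c * c * sqn w = c + c by rewrite /c -mulrA divfK //; lra.
  by rewrite scalerDl opprB !addrA subrK addrK.
rewrite /g mulmxBr mulmx1 -scalemxAr mulmxA xw mul_scalar_mx scalerA.
have -> : 2 / sqn w * (sqn w / 2) = 1 by rewrite mulrA divfK // divff.
by rewrite scale1r /w opprB addrC subrK.
Qed.

Section SmallBall.
Context (R : realType) (d : nat) (k : 'I_d.+1)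
  (gamma : probability (g_sigma_algebraType (@open (oproj R k))) R).

(** The projections that shrink [x] to length at most [sqrt c]. *)
Definition short (x : 'rV[R]_d) (c : R) :
    set (g_sigma_algebraType (@open (oproj R k))) :=
  [set U : oproj R k | sqn (x *m oproj_mx U) <= c].

Lemma measurable_short x c : measurable (short x c).
Proof.
rewrite -[short x c]setCK; apply: measurableC; apply: sub_sigma_algebra.
rewrite openC.
pose f (U : oproj R k) := sqn (x *m oproj_mx U).
rewrite (_ : short x c = f @^-1` [set r | r <= c]) //.
apply: preimage_closed; last exact: closed_le.
have cx i : continuous (fun U : oproj R k => (x *m oproj_mx U) 0 i).
  under eq_fun do rewrite mxE; apply: continuous_big_sum => j V.
  apply: (@continuous_comp _ _ _ (fun U : oproj R k => oproj_mx U j i) ( *%R (x 0 j))).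
    apply: (@continuous_comp _ _ _ (@oproj_mx R d k) (fun M : 'M[R]_d => M j i)).
      exact: initial_continuous.
    exact: coord_continuous.
  exact: mulrl_continuous.
move=> U _; apply: continuous_big_sum => i V.
apply: (@continuous_comp _ _ _ (fun U : oproj R k => (x *m oproj_mx U) 0 i) (fun r => r ^+ 2)).
  exact: cx.
exact: exprn_continuous.
Qed.

Definition prob (B : set (g_sigma_algebraType (@open (oproj R k)))) : R :=
  fine (gamma B).

Lemma prob_le1 B : measurable B -> prob B <= 1.
Proof.
by move=> mB; rewrite -lee_fin fineK ?fin_num_measure // probability_le1.
Qed.

Lemma le_prob B C : measurable B -> measurable C -> B `<=` C -> prob B <= prob C.
Proof.
move=> mB mC BC; apply: fine_le; rewrite ?fin_num_measure //.
by apply: le_measure; rewrite ?inE.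
Qed.

Lemma oproj_sym (U : oproj R k) : (oproj_mx U)^T = oproj_mx U.
Proof. by case/and3P: (oprojP U) => /eqP. Qed.

Lemma oproj_idem (U : oproj R k) : oproj_mx U *m oproj_mx U = oproj_mx U.
Proof. by case/and3P: (oprojP U) => _ /eqP. Qed.

Lemma oproj_rank (U : oproj R k) : \rank (oproj_mx U) = k.
Proof. by case/and3P: (oprojP U) => _ _ /eqP. Qed.

Hypothesis hgamma : Od_invariant gamma.

(** Some orthogonal [g] takes [x] to [y], and the action of [g] takes one event to
    the other. *)
Lemma prob_short_eq x y c : sqn x = sqn y -> prob (short x c) = prob (short y c).
Proof.
move=> /reflection_ex [g gO xg]; rewrite /prob -[in RHS](hgamma gO); last first.
  exact: measurable_short.
congr (fine (gamma _)); rewrite /short /preimage; apply/funext => U /=.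
by rewrite -xg !mulmxA -[x *m g *m g^T]mulmxA gO mulmx1 (sqnE (_ *m g)) trmx_mul
  mulmxA -(mulmxA _ g) gO mulmx1 -sqnE.
Qed.

(** Rescale [y] to the length of [x]. *)
Lemma prob_short_scale x y (c D : R) : 0 < sqn x -> 0 < sqn y -> 0 <= c ->
  sqn y <= D * sqn x -> prob (short x c) <= prob (short y (c * D)).
Proof.
move=> x0 y0 c0 yx; set a := Num.sqrt (sqn x / sqn y).
have a2 : a ^+ 2 = sqn x / sqn y by rewrite sqr_sqrtr // ltW // divr_gt0.
rewrite (@prob_short_eq x (a *: y)); last by rewrite sqnZ a2 divfK ?gt_eqF.
apply: le_prob; [exact: measurable_short..|] => U; rewrite /short /=.
rewrite -scalemxAl sqnZ a2 => h.
have -> : sqn (y *m U) = (sqn x / sqn y * sqn (y *m U)) * (sqn y / sqn x).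
  by field; rewrite !gt_eqF.
apply: ler_pM => //; last by rewrite ler_pdivrMr.
  by rewrite mulr_ge0 ?sqn_ge0 // divr_ge0 // ltW.
by rewrite divr_ge0 // ltW.
Qed.

(** By invariance the probability only depends on the length of [z], so after
    rescaling it is at most the average, with constant [c * d], over the lattice
    points [w] of the box [1, n]^d, whose squared length is at most
    [d * n ^+ 2].  For a fixed [U] the points [w] that count lie near the kernel
    of [U], whose dimension is [d - k]: at most order [n ^ (d - k)] among
    [n ^ d]. *)
Lemma small_ball (c : nat) : exists2 C : R, 1 <= C &
  forall z n, (0 < n)%N -> n%:R ^+ 2 <= sqn z -> prob (short z c%:R) <= C / n%:R ^+ k.
Proof.
have [C0 C0P] := lattice_near_subspace R d (c * d).
exists (1 + (C0 * d ^ d)%:R); first by rewrite lerDl.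
move=> z n n0 nz.
have nR : 0 < n%:R :> R by rewrite ltr0n.
have z0 : 0 < sqn z by apply: lt_le_trans nz; rewrite exprn_gt0.
have d0 : (0 < d)%N.
  rewrite lt0n; apply/eqP => d0; move: z0; rewrite /sqn big1 ?ltxx //.
  by move=> i; have := ltn_ord i; rewrite {2}d0.
pose w (f : {ffun 'I_d -> 'I_n}) : 'rV[R]_d := \row_i (f i).+1%:R.
have w_inj : injective w.
  move=> f g /rowP fg; apply/ffunP => i; apply/val_inj/eqP.
  by have /eqP := fg i; rewrite !mxE eqr_nat eqSS.
have wn f : sqn (w f) <= d%:R * n%:R ^+ 2.
  by apply: sqn_le_coord => i; rewrite mxE ger0_norm // ler_nat.
have w0 f : 0 < sqn (w f).
  apply: lt_le_trans (sqr_coord_le_sqn _ (Ordinal d0)).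
  by rewrite mxE exprn_gt0 // ltr0n.
have le_w f : prob (short z c%:R) <= prob (short (w f) (c * d)%:R).
  rewrite natrM; apply: prob_short_scale => //.
  by apply: le_trans (wn f) _; rewrite ler_pM2l // ltr0n.
have count_w U : \sum_f \1_(short (w f) (c * d)%:R) U <= (C0 * (d * n) ^ (d - k))%:R :> R.
  pose V : 'M[R]_d := 1%:M - oproj_mx U.
  have VT : V^T = V by rewrite /V linearB /= trmx1 oproj_sym.
  have VV : V *m V = V.
    by rewrite /V mulmxBl !mulmxBr !mul1mx mulmx1 oproj_idem subrr subr0.
  have rV : (\rank V <= d - k)%N.
    rewrite -[X in (_ <= _ - X)%N](oproj_rank U) -mxrank_ker; apply: mxrankS.
    by apply/sub_kermxP; rewrite /V mulmxBl mul1mx oproj_idem subrr.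
  pose s := [seq w f | f <- enum [pred f | U \in short (w f) (c * d)%:R]].
  have us : uniq s by rewrite map_inj_uniq // enum_uniq.
  have -> : \sum_f \1_(short (w f) (c * d)%:R) U = (size s)%:R :> R.
    rewrite size_map -cardE -sum1_card natr_sum [RHS]big_mkcond /=.
    by apply: eq_bigr => f _; rewrite indicE inE; case: (_ \in _).
  rewrite ler_nat; apply: leq_trans (leq_mul (leqnn C0) (leq_pexp2l _ rV)); last first.
    by rewrite muln_gt0 d0.
  apply: C0P => //; first by rewrite muln_gt0 d0.
  move=> _ /mapP[f + ->]; rewrite mem_enum !inE => fU; split.
  - by move=> i; rewrite mxE rpred_nat.
  - apply: le_trans (wn f) _; rewrite natrM exprMn ler_wpM2r ?sqr_ge0 //.
    by rewrite -natrX ler_nat -mulnn leq_pmulr.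
  - by rewrite /V mulmxBr mulmx1 opprB addrC subrK.
have sum_w := sum_prob_le gamma (fun f => measurable_short (w f) (c * d)%:R) count_w.
have : n%:R ^+ d * prob (short z c%:R) <= (C0 * (d * n) ^ (d - k))%:R.
  apply: le_trans sum_w.
  rewrite -natrX -[X in (X ^ _)%N](card_ord n) -[X in (_ ^ X)%N](card_ord d) -card_ffun.
  rewrite mulr_natl -sumr_const; apply: ler_sum => f _; exact: le_w.
have kd : (k <= d)%N by rewrite -ltnS.
rewrite -[X in n%:R ^+ X](subnK kd) exprD expnMn natrM natrM (natrX _ n) => h.
rewrite ler_pdivlMr ?exprn_gt0 // mulrC -(ler_pM2l (exprn_gt0 (d - k) nR)) mulrA.
apply: le_trans h _; rewrite mulrA mulrC ler_pM2l ?exprn_gt0 //.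
apply: (@le_trans _ _ (C0 * d ^ d)%:R); last by rewrite lerDr.
by rewrite -natrM ler_nat leq_mul2l leq_pexp2l ?orbT // leq_subr.
Qed.
End SmallBall.

(** * Expected number of close projections *)

Lemma powR_exprn (R : realType) (x a : R) n : 0 <= x ->
  (x ^+ n) `^ a = (x `^ a) ^+ n.
Proof.
move=> x0; elim: n => [|n IH]; first by rewrite !expr0 powR1.
by rewrite !exprS powRM ?exprn_ge0 // IH.
Qed.

(** Sets are counted through duplicate-free sequences of their elements, so that
    the bound includes finiteness. *)
Definition cube_growth (R : realType) d (A : set 'rV[R]_d) (sigma C : R) : Prop :=
  forall a l s, 1 <= l -> uniq s ->
  {in s, forall x, Defs.floor_set A x /\ Defs.cube a l x} ->
  (size s)%:R <= C * l `^ sigma.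

Section Potential.
Context (R : realType) (d : nat) (k : 'I_d.+1)
  (gamma : probability (g_sigma_algebraType (@open (oproj R k))) R).
Hypothesis hgamma : Od_invariant gamma.

(** The open ball of the sup norm, for which cubes are balls. *)
Definition within (x : 'rV[R]_d) (r : R) : bool := [forall i, `|x 0 i| < r].

(** The term of the least [j] with [z] within [2 ^ j] is the small ball bound.
    The other terms turn a sum over many [z] into numbers of points of cubes,
    without a partition into shells. *)
Lemma small_ball_dyadic (c : nat) : exists2 C : R, 0 <= C &
  forall z J, within z (2 ^+ J) ->
    prob gamma (short z c%:R) <= C * \sum_(j < J.+1) (within z (2 ^+ j))%:R / (2 ^+ k) ^+ j.
Proof.
have [C C1 CP] := small_ball hgamma c.
have C0 : 0 <= C by apply: le_trans C1.
exists (C * 2 ^+ k); first by rewrite mulr_ge0 // exprn_ge0.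
move=> z; elim=> [|J IH] zJ.
  rewrite big_ord1 zJ expr0 divr1 mulr1.
  apply: le_trans (prob_le1 _ (measurable_short _ _)) _.
  apply: mulr_ege1 => //; apply: exprn_ege1; exact: ler1n.
rewrite big_ord_recr /= mulrDr.
have [zJ'|zJ'] := boolP (within z (2 ^+ J)).
  apply: le_trans (IH zJ') _; rewrite lerDl.
  apply: mulr_ge0; last by rewrite divr_ge0 ?exprn_ge0.
  by rewrite mulr_ge0 // exprn_ge0.
rewrite zJ; move: zJ'; rewrite negb_forall => /existsP[i]; rewrite -leNgt => zi.
apply: (@le_trans _ _ (C / (2 ^ J)%:R ^+ k)).
  apply: CP; first by rewrite expn_gt0.
  apply: le_trans (sqr_coord_le_sqn _ i); rewrite -[leRHS]real_normK ?num_real //.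
  by rewrite lerXn2r ?nnegrE // natrX.
rewrite -[leLHS]add0r; apply: lerD.
  apply: mulr_ge0; first by rewrite mulr_ge0 // exprn_ge0.
  by apply: sumr_ge0 => j _; rewrite divr_ge0 // !exprn_ge0.
rewrite natrX exprAC exprS mul1r invfM mulrA mulfK //.
Qed.

(** Exchanging the sums in [small_ball_dyadic], the scale [j] contributes
    [2 ^ (- j k)] times the number of points in a cube of side of order
    [2 ^ (m + j)]. *)
Lemma potential_le (c : nat) (sigma Cg : R) (A : set 'rV[R]_d) :
  cube_growth A sigma Cg ->
  exists K : R, forall m J x0 s, uniq s ->
  {in s, forall y, Defs.floor_set A y /\ within (y - x0) (2 ^+ (m + J))} ->
  \sum_(y <- s) prob gamma (short (y - x0) (c%:R * 4 ^+ m)) <=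
  K * (2 ^+ m) `^ sigma * \sum_(j < J.+1) (2 `^ (sigma - k%:R)) ^+ j.
Proof.
move=> Ag; have [C C0 CP] := small_ball_dyadic c.
exists (C * Cg * 2 `^ sigma) => m J x0 s us sP.
have p2 n : 0 < 2 ^+ n :> R by rewrite exprn_gt0.
have shortE (y : 'rV[R]_d) : short y (c%:R * 4 ^+ m) = short (k := k) ((2 ^+ m)^-1 *: y) c%:R.
  apply/funext => U; rewrite /short /= -scalemxAl sqnZ exprVn -exprM mulnC exprM.
  rewrite -[2 ^+ 2]/(2 * 2) -natrM [_^-1 * _]mulrC ler_pdivrMr ?exprn_gt0 //.
have withinE y j : within ((2 ^+ m)^-1 *: y) (2 ^+ j) = within y (2 ^+ (m + j)).
  apply: eq_forallb => i; rewrite mxE normrM ger0_norm ?invr_ge0 ?ltW // mulrC.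
  by rewrite ltr_pdivrMr // exprD mulrC.
have count j : \sum_(y <- s) (within (y - x0) (2 ^+ (m + j)))%:R <=
    Cg * (2 * 2 ^+ (m + j)) `^ sigma.
  set w := 2 ^+ (m + j); rewrite -(natr_sum _ _ _ (fun y => within (y - x0) w : nat)).
  rewrite -big_mkcond sum1_count -size_filter.
  apply: (Ag (x0 - const_mx w)).
  - by rewrite /w -exprS exprn_ege1 // ler1n.
  - exact: filter_uniq.
  move=> y; rewrite mem_filter => /andP[/forallP yw ys]; split; first by case: (sP y ys).
  by move=> i; have := yw i; rewrite !mxE ltr_norml; lra.
under eq_bigr do rewrite shortE.
apply: (@le_trans _ _ (\sum_(y <- s) C *
    \sum_(j < J.+1) (within (y - x0) (2 ^+ (m + j)))%:R / (2 ^+ k) ^+ j)).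
  rewrite big_seq [leRHS]big_seq; apply: ler_sum => y ys.
  under eq_bigr do rewrite -withinE.
  by apply: CP; rewrite withinE; case: (sP y ys).
rewrite -mulr_sumr exchange_big /= -!mulrA ler_wpM2l //.
rewrite !mulr_sumr; apply: ler_sum => j _; rewrite -mulr_suml.
rewrite ler_pdivrMr ?exprn_gt0 //; apply: le_trans (count j) _.
rewrite powRM ?(ltW (p2 _)) // exprD powRM ?(ltW (p2 _)) // -!mulrA.
have -> : (2 `^ (sigma - k%:R)) ^+ j * (2 ^+ k) ^+ j = (2 ^+ j) `^ sigma :> R.
  rewrite powR_exprn // -exprMn -[2 ^+ k]powR_mulrn // -powRD ?subrK //.
  by rewrite pnatr_eq0 implybT.
by [].
Qed.
End Potential.

(** * Lower bound for the mass of projections *)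

Lemma dyadic_between (R : realType) (l : R) : 1 <= l ->
  exists J, l <= 2 ^+ J <= 2 * l.
Proof.
move=> l1; have ex : exists J, l <= 2 ^+ J.
  exists (Num.bound l); apply: ltW.
  have := archi_boundP (le_trans ler01 l1) => /lt_trans; apply.
  by rewrite -natrX ltr_nat ltn_expl.
case: (ex_minnP ex) => J lJ minJ; exists J; rewrite lJ /=.
case: J lJ minJ => [|J] lJ minJ; first by rewrite expr0; lra.
rewrite exprS ler_pM2l // leNgt; apply/negP => /ltW /minJ; by rewrite ltnn.
Qed.

Lemma powR2_gt1 (R : realType) (tau : R) : 0 < tau -> 1 < 2 `^ tau :> R.
Proof.
move=> t0; have := @gt0_ltr_powR R tau t0 1 2; rewrite powR1.
by apply; rewrite ?nnegrE // ltr1n.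
Qed.

Lemma powR2_lt1 (R : realType) (tau : R) : tau < 0 -> 2 `^ tau < 1 :> R.
Proof.
move=> t0; rewrite -[tau]opprK powRN invf_lt1 ?powR_gt0 //.
by rewrite powR2_gt1 // oppr_gt0.
Qed.

(** The sum is bounded if [tau < 0] and comparable to its last term if
    [tau > 0]; at [tau = 0] it would have [J + 1] terms equal to 1. *)
Lemma geometric_sum_le (R : realType) (tau : R) : tau != 0 ->
  exists2 G : R, 0 <= G & forall l J, 1 <= l -> 2 ^+ J <= 4 * l ->
  \sum_(j < J.+1) (2 `^ tau) ^+ j <= G * l `^ Num.max 0 tau.
Proof.
move=> tau0; set q : R := 2 `^ tau.
have q0 : 0 <= q by rewrite powR_ge0.
have [tauN|tauP] := ltP tau 0.
  have q1 : 0 < 1 - q.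
    by rewrite subr_gt0 powR2_lt1.
  exists (1 - q)^-1; first by rewrite invr_ge0 ltW.
  move=> l J l1 _; rewrite powRr0 mulr1 -[leRHS]mul1r ler_pdivlMr //.
  have := subrX1 q J.+1 => e.
  have -> : (\sum_(j < J.+1) q ^+ j) * (1 - q) = 1 - q ^+ J.+1.
    by rewrite mulrC -opprB mulNr -e opprB.
  by rewrite gerBl exprn_ge0.
have tauP' : 0 < tau by rewrite lt_def tau0.
have q1 : 0 < q - 1.
  by rewrite subr_gt0 powR2_gt1.
exists (q / (q - 1) * 4 `^ tau).
  by rewrite mulr_ge0 ?powR_ge0 // divr_ge0 // ltW.
move=> l J l1 J4; have l0 : 0 <= l by rewrite (le_trans ler01).
have -> : \sum_(j < J.+1) q ^+ j = (q ^+ J.+1 - 1) / (q - 1).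
  by rewrite subrX1 mulrAC divff ?mul1r // gt_eqF.
apply: (@le_trans _ _ (q ^+ J.+1 / (q - 1))).
  by rewrite ler_pM2r ?invr_gt0 // gerBl.
rewrite exprS mulrAC -!mulrA ler_wpM2l // ler_wpM2l ?invr_ge0 ?(ltW q1) //.

rewrite -powRM // (_ : q ^+ J = (2 ^+ J) `^ tau).

  by apply: ge0_ler_powR; rewrite ?nnegrE ?exprn_ge0 ?mulr_ge0 ?(ltW tauP') //.
by rewrite powR_exprn.
Qed.

Section FloorProjection.
Context (R : realType) (d : nat) (k : 'I_d.+1) (U : oproj R k).

(** Rounding before or after the projection makes a bounded difference, so that
    the floors of the image of [A] can be compared with the projections of lattice
    points. *)
Lemma floor_proj_close (a : 'rV[R]_d) :
  sqn (floor_vec a *m U - floor_vec (a *m U)) <= (4 * d)%:R.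
Proof.
have -> : floor_vec a *m U - floor_vec (a *m U) =
    (floor_vec a - a) *m U + - (floor_vec (a *m U) - a *m U).
  by rewrite mulmxBl opprB addrA subrK.
rewrite (le_trans (sqnD_le _ _)) // sqnN natrM.
have := sqn_floor a; have := sqn_floor (a *m U).
have := sqn_proj_le (floor_vec a - a) (oproj_sym U) (oproj_idem U); lra.
Qed.

Lemma sqn_le_cube (x : 'rV[R]_d) l :
  Defs.cube (const_mx (- l)) (2 * l) x -> sqn x <= d%:R * l ^+ 2.
Proof.
move=> xl; apply: sqn_le_coord => i.
by have := xl i; rewrite mxE ler_norml; lra.
Qed.

Lemma cube_of_sqn (y : 'rV[R]_d) (l : R) : 0 < l -> sqn y < l ^+ 2 ->
  Defs.cube (const_mx (- l)) (2 * l) y.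
Proof.
move=> l0 yl i; rewrite mxE.
have : `|y 0 i| < l.
  rewrite -(ltr_sqr (x := `|_|)) ?nnegrE ?(ltW l0) // real_normK ?num_real //.
  exact: le_lt_trans (sqr_coord_le_sqn y i) yl.
by rewrite ltr_norml; lra.
Qed.
End FloorProjection.

(** Positivity of the mass measure in terms of finite sets of lattice points. *)
Definition mass_growth (R : realType) d (A : set 'rV[R]_d) (alpha : R) : Prop :=
  exists2 c : R, 0 < c & forall L, exists l s, [/\ L <= l, uniq s,
    {in s, forall x, Defs.floor_set A x /\ Defs.cube (const_mx (- l)) (2 * l) x} &
    c * l `^ alpha <= (size s)%:R].

Section LowerBound.
Context (R : realType) (d : nat) (k : 'I_d.+1)
  (gamma : probability (g_sigma_algebraType (@open (oproj R k))) R).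
Hypothesis hgamma : Od_invariant gamma.
Variables (A : set 'rV[R]_d) (sigma Cg alpha : R).
Hypothesis Ag : cube_growth A sigma Cg.
Hypothesis sk : sigma != k%:R.

(** A second moment argument: the energy of the points of a box is the number
    of pairs that [U] brings close together.  Its expectation is bounded by
    [potential_le], and a box with few such pairs has many floors in its image. *)
Lemma ae_mass_growth_proj : mass_growth A alpha ->
  {ae gamma, forall U : oproj R k,
     mass_growth (proj_image U A) (alpha - Num.max 0 (sigma - k%:R))}.
Proof.
case=> c c0 /(_ (_ : R)) Am; set delta := Num.max _ _.
have [K KP] := potential_le hgamma (16 * d) Ag.
have [|G G0 GP] := @geometric_sum_le R (sigma - k%:R); first by rewrite subr_eq0.
have /choice[l /choice[s lsP]] : forall n : nat, exists l s,
    [/\ n.+1%:R <= l, uniq s, {in s, forall x, Defs.floor_set A x /\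
       Defs.cube (const_mx (- l)) (2 * l) x} & c * l `^ alpha <= (size s)%:R].
  by move=> n; exact: Am.
have l1 n : 1 <= l n by case: (lsP n) => h _ _ _; apply: le_trans h; rewrite ler1n.
have l0 n : 0 < l n by apply: lt_le_trans (l1 n).
have N0 n : 0 < (size (s n))%:R :> R.
  by case: (lsP n) => _ _ _; apply: lt_le_trans; rewrite mulr_gt0 // powR_gt0.
pose w n (_ : 'rV[R]_d * 'rV[R]_d) := ((size (s n))%:R * l n `^ delta)^-1.
pose E (n : nat) (p : 'rV[R]_d * 'rV[R]_d) := short (k := k) (p.2 - p.1) (16 * d)%:R.
pose pairs n := [seq (x, y) | x <- s n, y <- s n].
have w0 n p : 0 <= w n p by rewrite invr_ge0 mulr_ge0 ?powR_ge0 // ltW.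
have EK n : \sum_(p <- pairs n) w n p * fine (gamma (E n p)) <= `|K| * G.
  have [ln us sP sc] := lsP n.
  rewrite -mulr_sumr mulrC ler_pdivrMr ?mulr_gt0 ?powR_gt0 //.
  rewrite big_allpairs_dep /=.
  (* any two points of the box are within 2 ^ J of each other *)
  have [J /andP[J1 J2]] : exists J, 2 * l n <= 2 ^+ J <= 2 * (2 * l n).
    by apply: dyadic_between; have := l1 n; lra.
  apply: (@le_trans _ _ (\sum_(x <- s n) `|K| * (G * l n `^ delta))); last first.
    rewrite big_const_seq count_predT iter_addr_0.
    by rewrite -[leLHS]mulr_natl (_ : _ * _ = `|K| * G * ((size (s n))%:R * l n `^ delta)) //; ring.
  rewrite big_seq [leRHS]big_seq; apply: ler_sum => x xs.
  apply: (@le_trans _ _ (K * 1 * \sum_(j < J.+1) (2 `^ (sigma - k%:R)) ^+ j)).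
    have := KP 0 J x (s n) us; rewrite expr0 powR1 mulr1; apply => y ys.
    split; first by case: (sP y ys).
    apply/forallP => i; have [_ /(_ i)] := sP y ys; have [_ /(_ i)] := sP x xs.
    by rewrite !mxE ltr_norml; lra.
  rewrite mulr1; apply: (@le_trans _ _ (`|K| * \sum_(j < J.+1) (2 `^ (sigma - k%:R)) ^+ j)).
    rewrite ler_wpM2r ?ler_norm //; apply: sumr_ge0 => j _.
    by rewrite exprn_ge0 // powR_ge0.
  by rewrite ler_wpM2l //; apply: GP => //; rewrite (le_trans J2) // mulrA -natrM.
have mE n p : measurable (E n p) by exact: measurable_short.
apply: filterS (ae_bounded_infinitely_often w0 mE EK) => U [t tU].
(* t may be nonpositive *)
pose T := Num.max t 1; have T0 : 0 < T by rewrite lt_max ltr01 orbT.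
have /choice[f fP] : forall x : 'rV[R]_d, exists y : 'rV[R]_d,
    Defs.floor_set A x ->
    Defs.floor_set (proj_image U A) y /\ sqn (x *m U - y) <= (4 * d)%:R.
  move=> x.
  have [[a Aa <-]|nA] := pselect (Defs.floor_set A x); last by exists 0 => /nA.
  exists (floor_vec (a *m U)) => _; split; last exact: floor_proj_close.
  by exists (a *m U) => //; exists a.
(* the image of the box of half side l lies in the box of half side r * l,
   since 2 * (d * l ^+ 2 + 4 * d) < (r * l) ^+ 2 for l >= 1 *)
pose r : R := (10 * d).+1%:R.
have r0 : 0 < r by rewrite ltr0n.
pose b := alpha - delta.
exists (c / T / r `^ b); first by rewrite !divr_gt0 // powR_gt0.
move=> L; have [n Ln tn] := tU (Num.bound `|L|).
have [ln us sP sc] := lsP n.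
exists (r * l n), (undup (map f (s n))); split.
- apply: (@le_trans _ _ (l n)); last by rewrite ler_peMl ?(ltW (l0 n)) // ler1n.
  apply: le_trans ln; apply: le_trans (ler_norm L) _.
  apply: ltW; apply: lt_le_trans (archi_boundP (normr_ge0 L)) _.
  by rewrite ler_nat leqW.
- exact: undup_uniq.
- move=> _ /[!mem_undup] /mapP[x xs ->]; have [xA xl] := sP x xs.
  have [fA fx] := fP x xA; split => //; apply: cube_of_sqn; first exact: mulr_gt0.
  have -> : f x = x *m U + - (x *m U - f x) by rewrite opprB addrC subrK.
  apply: le_lt_trans (sqnD_le _ _) _; rewrite sqnN.
  have l21 : 1 <= l n ^+ 2 by rewrite exprn_ege1.
  have dl : d%:R <= d%:R * l n ^+ 2 by rewrite ler_peMr.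
  have rl : r * l n ^+ 2 <= (r * l n) ^+ 2.
    by rewrite exprMn ler_wpM2r ?sqr_ge0 // expr2 ler_peMr ?(ltW r0) // ler1n.
  apply: lt_le_trans rl; have -> : r = 10 * d%:R + 1 by rewrite /r mulrSr natrM.
  rewrite [ltRHS]mulrDl mul1r -[10 * _ * _]mulrA.
  move: fx (sqn_proj_le x (oproj_sym U) (oproj_idem U)) (sqn_le_cube xl).
  rewrite natrM; lra.
have pairs_le : \sum_(x <- s n) \sum_(y <- s n) (f x == f y)%:R <=
    T * ((size (s n))%:R * l n `^ delta).
  rewrite -ler_pdivrMr ?mulr_gt0 ?powR_gt0 // mulrC.
  apply: (@le_trans _ _ t); last by rewrite le_max lexx.
  apply: le_trans tn; rewrite -mulr_sumr ler_wpM2l ?(w0 n (0, 0)) //.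
  rewrite big_allpairs_dep /= big_seq [leRHS]big_seq; apply: ler_sum => x xs.
  rewrite big_seq [leRHS]big_seq; apply: ler_sum => y ys.
  have [fxy|//] := eqVneq (f x) (f y); rewrite indicE mem_set // /E /short /=.
  have [xA _] := sP x xs; have [yA _] := sP y ys.
  have [_ fx] := fP x xA; have [_ fy] := fP y yA.
  have -> : (y - x) *m U = (y *m U - f y) + - (x *m U - f x).
    by rewrite mulmxBl fxy opprB addrA subrK.
  apply: le_trans (sqnD_le _ _) _; rewrite sqnN; move: fx fy; rewrite !natrM; lra.
have CS := sqr_size_le_pairs R (s n) f.
set u := (size (undup _))%:R in CS *.
have : c * l n `^ alpha <= u * (T * l n `^ delta).
  apply: le_trans sc _; rewrite -(ler_pM2l (N0 n)) -expr2.
  apply: le_trans CS _; apply: le_trans (ler_wpM2l _ pairs_le) _ => //.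
  by rewrite [leLHS](_ : _ = (size (s n))%:R * (u * (T * l n `^ delta))) //; ring.
rewrite powRM ?(ltW r0) ?(ltW (l0 n)) // => h.
have -> : c / T / r `^ b * (r `^ b * l n `^ b) = c * l n `^ b / T.
  by field; rewrite !gt_eqF // powR_gt0.
rewrite ler_pdivrMr // /b powRB; last by rewrite (gt_eqF (l0 n)) implybT.
rewrite mulrA ler_pdivrMr ?powR_gt0 //.
by rewrite -mulrA.
Qed.
End LowerBound.

(** * Upper bound for the mass of projections *)

(** The weakening of [cube_growth] to cubes centred at the origin. *)
Definition mass_bound (R : realType) d (B : set 'rV[R]_d) (beta C : R) : Prop :=
  forall l s, 1 <= l -> uniq s ->
  {in s, forall x, Defs.floor_set B x /\ Defs.cube (const_mx (- l)) (2 * l) x} ->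
  (size s)%:R <= C * l `^ beta.

Section UpperBound.
Context (R : realType) (d : nat) (k : 'I_d.+1).

(** The floors of the points of the range of [U] stay near a subspace of
    dimension [k]. *)
Lemma mass_bound_proj_dim (A : set 'rV[R]_d) (U : oproj R k) :
  exists C, mass_bound (proj_image U A) k%:R C.
Proof.
have [C0 C0P] := lattice_near_subspace R d d.
exists (C0%:R * (2 * d.+1%:R) `^ k%:R) => l s l1 us sP.
have [J /andP[lJ Jl]] := dyadic_between l1.
have l0 : 0 <= l by apply: le_trans l1.
have := C0P U (d.+1 * 2 ^ J)%N s (oproj_sym U) (oproj_idem U).
rewrite muln_gt0 expn_gt0 => /(_ isT us) h.
apply: (@le_trans _ _ (C0 * (d.+1 * 2 ^ J) ^ k)%:R).
  rewrite ler_nat -[X in (_ ^ X)%N](oproj_rank U); apply: h => y ys; have [yA yl] := sP y ys.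
  split; first exact: floor_set_lattice yA.
    apply: le_trans (sqn_le_cube yl) _; rewrite natrM exprMn natrX.
    apply: ler_pM; rewrite ?sqr_ge0 //; last by rewrite lerXn2r ?nnegrE // exprn_ge0.
    by rewrite -natrX ler_nat -mulnn mulnS mulSn; lia.
  have [_ [a _ <-] <-] := yA; set v := floor_vec _.
  have -> : v - v *m U = (v - a *m U) - (v - a *m U) *m U.
    by rewrite mulmxBl -mulmxA oproj_idem opprB addrA subrK.
  apply: le_trans (sqn_floor (a *m U)); rewrite -/v.
  by rewrite [leRHS](sqn_pythagoras _ (oproj_sym U) (oproj_idem U)) lerDr sqn_ge0.
rewrite natrM -mulrA ler_wpM2l // natrX -powR_mulrn // -powRM // ?mulr_ge0 //.
apply: ge0_ler_powR; rewrite ?nnegrE // ?mulr_ge0 //.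
by rewrite natrM natrX [2 * _]mulrC -mulrA ler_pM2l // ltr0n.
Qed.

Lemma within_ex (s : seq 'rV[R]_d) : exists N, {in s, forall x, forall n, (N <= n)%N ->
  within x (2 ^+ n)}.
Proof.
elim: s => [|x s [N NP]]; first by exists 0%N.
have [M /andP[M1 _]] := dyadic_between (ler_wpDr (sqn_ge0 x) (lexx 1)).
exists (maxn N M) => y; rewrite inE => /orP[/eqP ->|ys] n; rewrite geq_max => /andP[Nn Mn].
  apply/forallP => i; apply: (@lt_le_trans _ _ (1 + sqn x)); last first.
    by apply: le_trans M1 _; rewrite ler_weXn2l // ler1n.
  have := sqr_coord_le_sqn x i; rewrite -[X in X <= _ -> _]real_normK ?num_real //.
  have := sqr_ge0 (`|x 0 i| - 1); nra.
exact: NP.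
Qed.

Context (gamma : probability (g_sigma_algebraType (@open (oproj R k))) R).
Hypothesis hgamma : Od_invariant gamma.
Variables (A : set 'rV[R]_d) (sigma Cg beta : R).
Hypothesis Ag : cube_growth A sigma Cg.
Hypothesis sb : sigma < beta.
Hypothesis b0 : 0 <= beta.
Hypothesis bk : beta < k%:R.

(** A first moment argument: the expectation of the sum over [m < n] of
    [2 ^ (- beta m)] times the number of points [x] of the box of half side
    [2 ^ n] with [|x U|] of order at most [2 ^ m] is bounded uniformly in [n]. *)
Lemma ae_few_short :
  {ae gamma, forall U : oproj R k, exists t, forall m s, uniq s ->
     {in s, forall x, Defs.floor_set A x /\ sqn (x *m U) <= (10 * d)%:R * 4 ^+ m} ->
     (size s)%:R <= t * (2 ^+ m) `^ beta}.
Proof.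
have [K KP] := potential_le hgamma (10 * d) Ag.
have bounded (tau : R) : tau < 0 ->
    exists2 G : R, 0 <= G & forall J, \sum_(j < J) (2 `^ tau) ^+ j <= G.
  move=> t0; have [|G G0 GP] := @geometric_sum_le R tau; first by rewrite lt_eqF.
  exists G => // -[|J]; first by rewrite big_ord0.
  have := GP (2 ^+ J) J; rewrite max_l ?(ltW t0) // powRr0 mulr1; apply.
    by rewrite exprn_ege1 // ler1n.
  by rewrite ler_peMl ?exprn_ge0 // ler1n.
have [|G G0 GP] := bounded (sigma - k%:R); first by rewrite subr_lt0 (lt_trans sb).
have [|H H0 HP] := bounded (sigma - beta); first by rewrite subr_lt0.
pose S n : set 'rV[R]_d := [set x | Defs.floor_set A x /\ within x (2 ^+ n)].
have finS n : finite_set (S n).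
  apply: (@lattice_near_finite _ _ 0 (2 ^ n)) => x [xA /forallP xn].
  split; first exact: floor_set_lattice xA.
  by move=> i; rewrite mxE subr0 natrX ltW.
have /choice[e eP] : forall n, exists e : seq 'rV[R]_d, uniq e /\ forall x, x \in e <-> S n x.
  move=> n; have /finite_seqP[e eS] := finS n; exists (undup e); split; first exact: undup_uniq.
  by move=> x; rewrite mem_undup eS.
pose pts n := [seq (m, x) | m <- index_iota 0 n, x <- e n].
pose w (n : nat) (p : nat * 'rV[R]_d) := ((2 ^+ p.1) `^ beta : R)^-1.
pose E (n : nat) (p : nat * 'rV[R]_d) := short (k := k) p.2 ((10 * d)%:R * 4 ^+ p.1).
have w0 n p : 0 <= w n p by rewrite invr_ge0 powR_ge0.
have mE n p : measurable (E n p) by exact: measurable_short.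
have EK n : \sum_(p <- pts n) w n p * fine (gamma (E n p)) <= `|K| * G * H.
  rewrite big_allpairs_dep /=.
  apply: (@le_trans _ _ (\sum_(m < n) `|K| * G * (2 `^ (sigma - beta)) ^+ m)); last first.
    by rewrite -mulr_sumr ler_wpM2l // mulr_ge0.
  rewrite big_mkord; apply: ler_sum => m _.
  rewrite /w /= -mulr_sumr mulrC ler_pdivrMr ?powR_gt0 ?exprn_gt0 //.
  have -> : `|K| * G * (2 `^ (sigma - beta)) ^+ m * (2 ^+ m) `^ beta =
      `|K| * (2 ^+ m) `^ sigma * G.
    rewrite !powR_exprn // -[LHS]mulrA -exprMn -powRD ?subrK 1?mulrAC //.
    by rewrite pnatr_eq0 implybT.
  apply: (@le_trans _ _ (K * (2 ^+ m) `^ sigma *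
      \sum_(j < (n - m).+1) (2 `^ (sigma - k%:R)) ^+ j)).
    have := KP m (n - m)%N 0 (e n) (eP n).1.
    under eq_bigr do rewrite subr0; apply => x /(eP n).2[xA xn].
    by rewrite subr0 subnKC // ltnW.
  apply: (@le_trans _ _ (`|K| * (2 ^+ m) `^ sigma *
      \sum_(j < (n - m).+1) (2 `^ (sigma - k%:R)) ^+ j)).
    rewrite ler_wpM2r ?ler_wpM2r ?powR_ge0 ?ler_norm //.
    by apply: sumr_ge0 => j _; rewrite exprn_ge0 // powR_ge0.
  by rewrite ler_wpM2l // mulr_ge0 // powR_ge0.
apply: filterS (ae_bounded_infinitely_often w0 mE EK) => U [t tU].
exists t => m s us sP.
have [N NP] := within_ex s.
have [n Nn tn] := tU (maxn N m.+1); move: Nn; rewrite geq_max => /andP[Nn mn].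
rewrite -ler_pdivrMr ?powR_gt0 ?exprn_gt0 //; apply: le_trans tn.
rewrite big_allpairs_dep /= (big_rem m) /=; last by rewrite mem_index_iota.
rewrite -[leLHS]addr0; apply: lerD; last first.
  by apply: sumr_ge0 => i _; apply: sumr_ge0 => x _; rewrite mulr_ge0.
rewrite /w /= -mulr_sumr mulrC ler_wpM2l ?invr_ge0 ?powR_ge0 //.
rewrite (eq_bigr (fun x => (U \in E n (m, x) : nat)%:R)); last by move=> x _; rewrite indicE.
rewrite -natr_sum -big_mkcond sum1_count -size_filter ler_nat.
apply: uniq_leq_size => // x xs; have [xA xU] := sP x xs.
rewrite mem_filter; apply/andP; split; first by rewrite /= inE.
by apply/(eP n).2; split => //; exact: NP.
Qed.

(** Each floor of the image lies at bounded distance of [x U] for some lattice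
    point [x] counted in [ae_few_short], and boundedly many floors correspond to
    the same [x]. *)
Lemma ae_mass_bound_proj :
  {ae gamma, forall U : oproj R k, exists C, mass_bound (proj_image U A) beta C}.
Proof.
apply: (@filterS _ _ (ae_filter_ringOfSetsType gamma) _ _ _ ae_few_short) => U [t tU].
pose r := (4 * d)%N; pose F := ((2 * r).+1 ^ d)%N.
exists (`|t| * 2 `^ beta * F%:R) => l s l1 us sP.
have l0 : 0 <= l by apply: le_trans l1.
have /choice[g gP] : forall y : 'rV[R]_d, exists x : 'rV[R]_d,
    Defs.floor_set (proj_image U A) y ->
    Defs.floor_set A x /\ sqn (x *m U - y) <= (4 * d)%:R.
  move=> y; have [[_ [a Aa <-] <-]|nA] := pselect (Defs.floor_set (proj_image U A) y).
    by exists (floor_vec a) => _; split; [exists a|exact: floor_proj_close].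
  by exists 0 => /nA.
have fibre x : (count (fun y => g y == x) s <= F)%N.
  rewrite -size_filter; apply: (@lattice_near_le _ _ (x *m U)); first exact: filter_uniq.
  move=> y; rewrite mem_filter => /andP[/eqP gy ys]; have [yA _] := sP y ys.
  split; first exact: floor_set_lattice yA.
  move=> i; have [_] := gP y yA; rewrite gy => yU.
  rewrite -ler_sqr ?nnegrE // real_normK ?num_real //.
  rewrite (@le_trans _ _ (4 * d)%:R) //; last first.
    by rewrite -natrX ler_nat /r; case: (4 * d)%N => // p; rewrite -mulnn leq_pmulr.
  apply: le_trans yU; apply: le_trans (sqr_coord_le_sqn _ i).
  by rewrite !mxE -sqrrN opprB.
have [m /andP[lm ml]] := dyadic_between l1.
have : (size (undup (map g s)))%:R <= t * (2 ^+ m) `^ beta.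
  apply: tU; first exact: undup_uniq.
  move=> _ /[!mem_undup] /mapP[y ys ->]; have [yA yl] := sP y ys.
  have [gA gU] := gP y yA; split => //.
  have -> : g y *m U = y + (g y *m U - y) by rewrite addrC subrK.
  apply: le_trans (sqnD_le _ _) _.
  have l2 : l ^+ 2 <= 4 ^+ m.
    rewrite (_ : 4 = 2 ^+ 2); last by rewrite -natrX.
    by rewrite -exprM mulnC exprM lerXn2r ?nnegrE ?exprn_ge0.
  have dl : d%:R * l ^+ 2 <= d%:R * 4 ^+ m by rewrite ler_wpM2l.
  have dm : d%:R <= d%:R * 4 ^+ m :> R by rewrite ler_peMr // exprn_ege1 // ler1n.
  have := sqn_le_cube yl; move: gU; rewrite !natrM -[X in _ -> _ -> _ <= X]mulrA; lra.
move=> h; apply: (@le_trans _ _ ((size (undup (map g s)))%:R * F%:R)).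
  by rewrite -natrM ler_nat; exact: size_le_fibers.
rewrite -!mulrA [F%:R * _]mulrC !mulrA ler_wpM2r //; apply: le_trans h _.
apply: (@le_trans _ _ (`|t| * (2 ^+ m) `^ beta)).
  by rewrite ler_wpM2r ?powR_ge0 ?ler_norm.
rewrite -mulrA ler_wpM2l // -powRM //.
by apply: ge0_ler_powR; rewrite ?nnegrE ?exprn_ge0 ?mulr_ge0.
Qed.
End UpperBound.

(** * Densities as cardinals *)

Section Densities.
Context (R : realType) (d : nat).
Implicit Types (B : set 'rV[R]_d).

Lemma lattice_cube_size (a : 'rV[R]_d) (l : R) (r : nat) s : uniq s -> l <= r%:R ->
  {in s, forall x, lattice x /\ Defs.cube a l x} -> (size s <= (2 * r).+1 ^ d)%N.
Proof.
move=> us lr sP; apply: (@lattice_near_le _ _ a) => // x /sP[xZ xa]; split => // i.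
by have := xa i; rewrite ler_norml; lra.
Qed.

Lemma densityE B a (l : R) : 0 < l -> exists s, [/\ uniq s,
  forall x, x \in s <-> Defs.floor_set B x /\ Defs.cube a l x &
  forall alpha, density alpha B (Defs.cube a l) l = ((size s)%:R / l `^ alpha)%:E].
Proof.
move=> l0; set S := Defs.floor_set B `&` Defs.cube a l.
have finS : finite_set S.
  apply: (@lattice_near_finite _ _ a (Num.bound l)) => x [xB xa].
  split; first exact: floor_set_lattice xB.
  move=> i; apply: (@le_trans _ _ l); last exact/ltW/archi_boundP/ltW.
  by have := xa i; rewrite ler_norml; lra.
exists (enum_fset (fset_set S)); split; first exact: fset_uniq.
  by move=> x; rewrite -[X in X <-> _]/(is_true (x \in fset_set S)) in_fset_set // inE.
by move=> alpha; rewrite /density /counting asboolT // inver gt_eqF ?powR_gt0.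
Qed.

Lemma powR_eventually (tau C eps : R) : 0 < tau -> 0 < eps ->
  exists2 L, 1 <= L & forall l, L <= l -> C <= eps * l `^ tau.
Proof.
move=> t0 e0; pose M := (`|C| / eps) `^ tau^-1.
have M0 : 0 <= M by rewrite powR_ge0.
exists (1 + M); first by rewrite lerDl.
move=> l Ml; apply: le_trans (ler_norm C) _.
rewrite mulrC -ler_pdivrMr //.
apply: (@le_trans _ _ (M `^ tau)).
  by rewrite -powRrM mulVf ?gt_eqF // powRr1 // divr_ge0 // ltW.
by apply: ge0_ler_powR; rewrite ?nnegrE ?(ltW t0) //; lra.
Qed.

Lemma cube_growthS B sigma sigma' C : cube_growth B sigma C -> sigma <= sigma' ->
  cube_growth B sigma' `|C|.
Proof.
move=> BC ss a l s l1 us sP; apply: le_trans (BC a l s l1 us sP) _.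
apply: (@le_trans _ _ (`|C| * l `^ sigma)).
  by rewrite ler_wpM2r ?powR_ge0 ?ler_norm.
by rewrite ler_wpM2l // ler_powR.
Qed.

Lemma cube_growth_trivial B : cube_growth B d%:R ((5 ^ d)%:R).
Proof.
move=> a l s l1 us sP; have l0 : 0 <= l by apply: le_trans l1.
pose r := (Num.truncn l).+1.
have rl : r%:R <= 2 * l.
  have := truncn_le l; rewrite l0 /r mulrSr; lra.
apply: (@le_trans _ _ (((2 * r).+1 ^ d)%:R)).
  rewrite ler_nat; apply: (@lattice_cube_size a l) => //.
    by rewrite ltW // truncnS_gt.
  by move=> x /sP[xB xa]; split => //; exact: floor_set_lattice xB.
rewrite powR_mulrn // !natrX -exprMn lerXn2r ?nnegrE ?mulr_ge0 //.
rewrite -natr1 natrM; lra.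
Qed.

Lemma mass_bound_trivial B : mass_bound B d%:R ((10 ^ d)%:R).
Proof.
move=> l s l1 us sP; have l0 : 0 <= l by apply: le_trans l1.
have := cube_growth_trivial (a := const_mx (- l)) (l := 2 * l) (s := s).
move=> /(_ B) h; apply: le_trans (h _ us sP) _; first lra.
by rewrite powRM // powR_mulrn // mulrA -natrX -natrM -expnMn.
Qed.
End Densities.

(** * Growth bounds and the two measures *)

Section Measures.
Context (R : realType) (d : nat).
Implicit Types (B : set 'rV[R]_d).

Lemma density_ge0 B a (l alpha : R) : 0 < l ->
  (0 <= density alpha B (Defs.cube a l) l)%E.
Proof.
by move=> l0; have [s [_ _ ->]] := densityE B a l0; rewrite lee_fin divr_ge0 ?powR_ge0.
Qed.

Lemma density_le B a (l alpha c : R) : 0 < l ->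
  (forall s, uniq s -> {in s, forall x, Defs.floor_set B x /\ Defs.cube a l x} ->
     (size s)%:R <= c * l `^ alpha) ->
  (density alpha B (Defs.cube a l) l <= c%:E)%E.
Proof.
move=> l0 h; have [s [us sP ->]] := densityE B a l0.
rewrite lee_fin ler_pdivrMr ?powR_gt0 //; apply: h => // x; exact: (sP x).1.
Qed.

Lemma le_density B a (l alpha c : R) s : 0 < l -> uniq s ->
  {in s, forall x, Defs.floor_set B x /\ Defs.cube a l x} ->
  c * l `^ alpha <= (size s)%:R ->
  (c%:E <= density alpha B (Defs.cube a l) l)%E.
Proof.
move=> l0 us sP h; have [s' [us' s'P ->]] := densityE B a l0.
rewrite lee_fin ler_pdivlMr ?powR_gt0 //; apply: le_trans h _.
by rewrite ler_nat; apply: uniq_leq_size => // x /sP/s'P.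
Qed.

(** The function under the limit in the counting measure. *)
Definition sup_density alpha B (l : R) : \bar R :=
  ereal_sup [set density alpha B (Defs.cube p.1 p.2) p.2
            | p in [set p : 'rV[R]_d * R | 0 < p.2 /\ l <= p.2]].

(** If the suprema of densities were infinite at all scales, the limit would be
    that of a constant function; so from some scale [L] on the densities are
    bounded, and smaller cubes contain boundedly many lattice points. *)
Lemma cube_growth_of_counting_measure B sigma : 0 <= sigma ->
  (counting_measure sigma B < +oo)%E -> exists C, cube_growth B sigma C.
Proof.
move=> s0 Bfin.
have [L gL] : exists L, (sup_density sigma B L < +oo)%E.
  apply: contrapT => /forallNP h; move: Bfin.
  rewrite /counting_measure (_ : (fun l => _) = fun=> +oo%E) ?lim_cst ?ltxx //.
  apply/funext => l; have := h l; rewrite -/(sup_density sigma B l).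
  by case: (sup_density _ _ _) => // r []; rewrite ltry.
have [M gM] : exists M : R, (sup_density sigma B L <= M%:E)%E.
  move: gL; case: (sup_density _ _ _) => [r| |] // _.
    by exists r; exact: lexx.
  by exists 0; exact: leNye.
pose F : R := ((2 * Num.bound `|L|).+1 ^ d)%:R.
exists (`|M| + F) => a l s l1 us sP; have l0 : 0 < l by apply: lt_le_trans l1.
have [Ll|lL] := leP L l.
  apply: (@le_trans _ _ (`|M| * l `^ sigma)); last first.
    by rewrite ler_wpM2r ?powR_ge0 // lerDl.
  rewrite -ler_pdivrMr ?powR_gt0 // -lee_fin.
  apply: (@le_trans _ _ (density sigma B (Defs.cube a l) l)).
    by apply: le_density us sP _ => //; rewrite divfK // gt_eqF // powR_gt0.
  apply: (@le_trans _ _ (sup_density sigma B L)).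
    by apply: ereal_sup_ubound; exists (a, l).
  by apply: le_trans gM _; rewrite lee_fin ler_norm.
apply: (@le_trans _ _ F).
  rewrite ler_nat; apply: (@lattice_cube_size _ _ a l) => //.
    apply: le_trans (ltW lL) _; apply: le_trans (ler_norm L) _.
    exact/ltW/archi_boundP.
  by move=> x /sP[xB xa]; split => //; exact: floor_set_lattice xB.
rewrite -[leLHS]mulr1; apply: ler_pM => //; first by rewrite lerDr.
by rewrite -(powRr0 l) ler_powR.
Qed.

Lemma counting_measure_eq0 B beta alpha C : cube_growth B beta C -> beta < alpha ->
  counting_measure alpha B = 0%E.
Proof.
move=> BC ba; have t0 : 0 < alpha - beta by rewrite subr_gt0.
have ge0 l : (0 <= sup_density alpha B l)%E.
  apply: le_ereal_sup_tmp; pose p : 'rV[R]_d * R := (0, Num.max l 1).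
  have p0 : 0 < p.2 by rewrite lt_max ltr01 orbT.
  exists (density alpha B (Defs.cube p.1 p.2) p.2); last exact: density_ge0.
  by exists p => //; split => //=; rewrite le_max lexx.
have small eps : 0 < eps -> \forall l \near +oo, (sup_density alpha B l <= eps%:E)%E.
  move=> e0; have [L L1 LP] := powR_eventually C t0 e0.
  exists L; split; first exact: num_real.
  move=> l Ll; apply: ge_ereal_sup => _ [[a l'] [/= l'0 ll'] <-].
  have Ll' : L <= l' by apply: le_trans (ltW Ll) ll'.
  apply: density_le => // s us sP.
  apply: le_trans (BC a l' s (le_trans L1 Ll') us sP) _.
  apply: (@le_trans _ _ (eps * l' `^ (alpha - beta) * l' `^ beta)).
    by rewrite ler_wpM2r ?powR_ge0 // LP.
  by rewrite -mulrA -powRD ?subrK // (gt_eqF l'0) implybT.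
rewrite /counting_measure; apply: cvg_lim => //.
rewrite -/(sup_density alpha B); apply/fine_cvgP; split.
  have := small 1 ltr01; apply: filterS => l le1.
  by rewrite ge0_fin_numE ?ge0 // (le_lt_trans le1) // ltry.
apply/cvgrPdist_le => eps e0; have := small eps e0; apply: filterS => l le1.
rewrite /= sub0r normrN ger0_norm ?fine_ge0 //.
by rewrite -lee_fin fineK // ge0_fin_numE ?ge0 // (le_lt_trans le1) // ltry.
Qed.

Lemma mass_measure_ge0 B alpha : (0 <= mass_measure alpha B)%E.
Proof.
apply: le_ereal_inf_tmp => _ [V [M [_ MV]] <-].
have l0 : 0 < Num.max (M + 1) 1 by rewrite lt_max ltr01 orbT.
apply: le_ereal_sup_tmp; eexists.
  by exists (Num.max (M + 1) 1) => //; apply: MV; rewrite lt_max ltrDl ltr01.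
by apply: density_ge0; rewrite mulr_gt0.
Qed.

Lemma mass_measure_eq0 B beta alpha C : mass_bound B beta C -> beta < alpha ->
  mass_measure alpha B = 0%E.
Proof.
move=> BC ba; have t0 : 0 < alpha - beta by rewrite subr_gt0.
apply/eqP; rewrite eq_le mass_measure_ge0 andbT.
apply/lee_addgt0Pr => eps e0; rewrite add0e.
(* the box of half side l has side 2 * l *)
have e'0 : 0 < eps * 2 `^ alpha by rewrite mulr_gt0 ?powR_gt0.
have [L L1 LP] := powR_eventually C t0 e'0.
apply: ge_ereal_inf; exists (ereal_sup ((fun l : R => density alpha B
    (Defs.cube (const_mx (- l)) (2 * l)) (2 * l)) @` [set l | L <= l])).
  by exists [set l | L <= l] => //; exists L; split; [exact: num_real|move=> x /ltW].
apply: ge_ereal_sup => _ [l /= Ll <-].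
have l1 : 1 <= l by apply: le_trans Ll.
have l0 : 0 < l by apply: lt_le_trans l1.
apply: density_le => [|s us sP]; first exact: mulr_gt0.
apply: le_trans (BC l s l1 us sP) _.
apply: (@le_trans _ _ (eps * 2 `^ alpha * l `^ (alpha - beta) * l `^ beta)).
  by rewrite ler_wpM2r ?powR_ge0 // LP.
rewrite powRM ?(ltW l0) // -!mulrA -powRD ?subrK //.
by rewrite (gt_eqF l0) implybT.
Qed.

Lemma mass_measure_gt0 B alpha : mass_growth B alpha -> (0 < mass_measure alpha B)%E.
Proof.
case=> c c0 Bc; pose c' := c / 2 `^ alpha.
have c'0 : 0 < c' by rewrite divr_gt0 // powR_gt0.
apply: (@lt_le_trans _ _ c'%:E); first by rewrite lte_fin.
apply: le_ereal_inf_tmp => _ [V [M [_ MV]] <-].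
have [l [s [Ml us sP sc]]] := Bc (Num.max (M + 1) 1).
move: Ml; rewrite ge_max => /andP[Ml l1]; have l0 : 0 < l by apply: lt_le_trans l1.
apply: le_ereal_sup_tmp; eexists.
  by exists l => //; apply: MV; apply: lt_le_trans Ml; rewrite ltrDl.
apply: le_density us sP _; first exact: mulr_gt0.
by rewrite powRM ?(ltW l0) // mulrA divfK // gt_eqF // powR_gt0.
Qed.

Lemma mass_growth_of_mass_measure B alpha : (0 < mass_measure alpha B)%E ->
  mass_growth B alpha.
Proof.
move=> B0; have [c c0 cB] : exists2 c : R, 0 < c & (c%:E < mass_measure alpha B)%E.
  move: B0; case: (mass_measure _ _) => [r| |] //; last by exists 1 => //; rewrite ltry.
  by rewrite lte_fin => r0; exists (r / 2); rewrite ?divr_gt0 // lte_fin; lra.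
exists (c * 2 `^ alpha); first by rewrite mulr_gt0 ?powR_gt0.
move=> L; pose V := [set l | Num.max L 1 <= l].
pose g (l : R) := density alpha B (Defs.cube (const_mx (- l)) (2 * l)) (2 * l).
have : (c%:E < ereal_sup (g @` V))%E.
  apply: lt_le_trans cB _; apply: ereal_inf_lbound; exists V => //.
  by exists (Num.max L 1); split; [exact: num_real|move=> x /ltW].
move=> /ereal_sup_gt[_ [l + <-]]; rewrite /g /V /= ge_max => /andP[Ll l1] cl.
have l0 : 0 < l by apply: lt_le_trans l1.
have [|s [us sP sE]] := @densityE R d B (const_mx (- l)) (2 * l); first exact: mulr_gt0.
exists l, s; split => //; first by move=> x /sP.
move: cl; rewrite sE lte_fin ltr_pdivlMr ?powR_gt0 ?mulr_gt0 // => /ltW.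
by rewrite powRM ?(ltW l0) // mulrA.
Qed.
End Measures.

(** * Dimensions of projections *)

Section Dimensions.
Context (R : realType) (d : nat).
Implicit Types (B : set 'rV[R]_d).

Lemma mass_dim_ge0 B : 0 <= mass_dim B.
Proof.
apply: lb_le_inf => [|x [] //]; exists (d%:R + 1); split; first by rewrite addr_ge0.
by apply: mass_measure_eq0 (@mass_bound_trivial R d B) _; rewrite ltrDl.
Qed.

Lemma mass_dim_le B beta C : 0 <= beta -> mass_bound B beta C -> mass_dim B <= beta.
Proof.
move=> b0 BC; apply/ler_addgt0Pr => e e0; apply: ge_inf.
  by exists 0 => x [].
split; first by rewrite addr_ge0 // ltW.
by apply: mass_measure_eq0 BC _; rewrite ltrDl.
Qed.

Lemma mass_growthS B alpha beta : beta <= alpha -> mass_growth B alpha ->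
  mass_growth B beta.
Proof.
move=> ba [c c0 Bc]; exists c => // L; have [l [s [Ll us sP sc]]] := Bc (Num.max L 1).
move: Ll; rewrite ge_max => /andP[Ll l1]; exists l, s; split => //.
by apply: le_trans sc; rewrite ler_pM2l // ler_powR.
Qed.

Lemma le_mass_dim B beta : mass_growth B beta -> beta <= mass_dim B.
Proof.
move=> Bb; apply: lb_le_inf.
  exists (d%:R + 1); split; first by rewrite addr_ge0.
  by apply: mass_measure_eq0 (@mass_bound_trivial R d B) _; rewrite ltrDl.
move=> a [a0 aB]; rewrite leNgt; apply/negP => ab.
have := mass_measure_gt0 (mass_growthS (ltW ab) Bb).
by rewrite aB ltxx.
Qed.

Lemma mass_growth_lt_dim B alpha : 0 <= alpha -> alpha < mass_dim B ->
  mass_growth B alpha.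
Proof.
move=> a0 aB; apply: mass_growth_of_mass_measure.
rewrite lt_def mass_measure_ge0 andbT; apply/eqP => a_eq0.
suff : mass_dim B <= alpha by rewrite leNgt aB.
by apply: ge_inf => //; exists 0 => x [].
Qed.

Lemma cube_growth_gt_dim B beta : counting_dim B < beta ->
  exists sigma C, [/\ 0 <= sigma, sigma < beta & cube_growth B sigma C].
Proof.
move=> /inf_lt[|s [s0 sB] sb].
  exists (d%:R + 1); split; first by rewrite addr_ge0.
  by apply: counting_measure_eq0 (@cube_growth_trivial R d B) _; rewrite ltrDl.
have [|C BC] := @cube_growth_of_counting_measure R d B s s0; first by rewrite sB ltry.
by exists s, C.
Qed.
End Dimensions.

Section Projections.
Context (R : realType) (d : nat) (k : 'I_d.+1)
  (gamma : probability (g_sigma_algebraType (@open (oproj R k))) R).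
Hypothesis hgamma : Od_invariant gamma.
Variables (A : set 'rV[R]_d).
Hypothesis hD : counting_dim A = mass_dim A.

Let ae_imp (P Q : oproj R k -> Prop) : (forall U, P U -> Q U) ->
  {ae gamma, forall U, P U} -> {ae gamma, forall U, Q U}.
Proof. by move=> PQ; apply: (@filterS _ _ (ae_filter_ringOfSetsType gamma)). Qed.

Lemma ae_mass_dim_proj_le eps : 0 < eps ->
  {ae gamma, forall U : oproj R k,
     mass_dim (proj_image U A) <= Num.min (k%:R : R) (mass_dim A) + eps}.
Proof.
move=> e0; have [kD|Dk] := leP k%:R (mass_dim A).
  apply: aeW => U; have [C UC] := mass_bound_proj_dim A U.
  apply: le_trans (mass_dim_le _ UC) _ => //; lra.
pose beta := Num.min (mass_dim A + eps) ((mass_dim A + k%:R) / 2).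
have Db : mass_dim A < beta by rewrite lt_min; apply/andP; split; lra.
have bk : beta < k%:R by rewrite gt_min; apply/orP; right; lra.
have be : beta <= mass_dim A + eps by rewrite ge_min lexx.
have b0 : 0 <= beta by apply: ltW; apply: le_lt_trans Db; exact: mass_dim_ge0.
have [s [C [s0 sb AC]]] : exists sigma C, [/\ 0 <= sigma, sigma < beta & cube_growth A sigma C].
  by apply: cube_growth_gt_dim; rewrite hD.
apply: ae_imp (ae_mass_bound_proj hgamma AC sb b0 bk) => U [C' UC].
exact: le_trans (mass_dim_le b0 UC) _.
Qed.

(** Apply [ae_mass_growth_proj] with exponents within [eps / 2] of the dimension,
    moving [sigma] slightly if it happens to be [k]. *)
Lemma ae_mass_dim_proj_ge eps : 0 < eps ->
  {ae gamma, forall U : oproj R k,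
     Num.min (k%:R : R) (mass_dim A) <= mass_dim (proj_image U A) + eps}.
Proof.
move=> e0; pose e := eps / 2.
have [D DE] : exists D, D = mass_dim A by exists (mass_dim A).
rewrite -DE; have [De|eD] := ltP (D - e) 0.
  apply: aeW => U; rewrite ge_min; apply/orP; right.
  move: De (mass_dim_ge0 (proj_image U A)); rewrite /e.
  by move: (mass_dim (proj_image U A)) => D'; lra.
have Ae : mass_growth A (D - e).
  by apply: mass_growth_lt_dim => //; rewrite -DE /e; lra.
have [s [C [s0 sb AC]]] : exists sigma C, [/\ 0 <= sigma, sigma < D + e & cube_growth A sigma C].
  by apply: cube_growth_gt_dim; rewrite hD -DE /e; lra.
have [s' [C' [sk s'b AC']]] : exists sigma C,
    [/\ sigma != k%:R, sigma < D + e & cube_growth A sigma C].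
  have [sk|sk] := eqVneq s k%:R; last by exists s, C.
  exists ((s + (D + e)) / 2), `|C|; split; [by apply/eqP => h; lra|lra|].
  by apply: cube_growthS AC _; lra.
apply: ae_imp (ae_mass_growth_proj hgamma AC' sk Ae) => U /le_mass_dim.
move: (mass_dim (proj_image U A)) => D' h.
have : Num.min (k%:R : R) D - eps <= D - e - Num.max 0 (s' - k%:R).
  rewrite /e in s'b *; rewrite minEle maxEle.
  by case: ifP => ?; case: ifP => ?; lra.
lra.
Qed.

Lemma ae_mass_dim_proj :
  {ae gamma, forall U : oproj R k,
     mass_dim (proj_image U A) = Num.min (k%:R : R) (mass_dim A)}.
Proof.
pose eps n : R := n.+1%:R^-1.
have eps0 n : 0 < eps n by rewrite invr_gt0.
have small (x y : R) : (forall n, x <= y + eps n) -> x <= y.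
  move=> h; apply/ler_addgt0Pr => e e0; apply: le_trans (h (Num.bound e^-1)) _.
  rewrite lerD2l /eps invf_ple ?posrE // ltW //.
  apply: lt_le_trans (archi_boundP _) _; first by rewrite invr_ge0 ltW.
  by rewrite ler_nat leqW.
have F := ae_filter_ringOfSetsType gamma.
have := ae_foralln (fun n => ae_mass_dim_proj_le (eps0 n)).
have := ae_foralln (fun n => ae_mass_dim_proj_ge (eps0 n)).
apply: (@filterS2 _ _ F) => U ge le; apply/eqP; rewrite eq_le.
by apply/andP; split; apply: small => n; [exact: le|exact: ge].
Qed.

Lemma ae_mass_measure_proj_gt0 : counting_regular A -> mass_regular A ->
  mass_dim A <> k%:R ->
  {ae gamma, forall U : oproj R k,
     (0 < mass_measure (Num.min (k%:R : R) (mass_dim A)) (proj_image U A))%E}.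
Proof.
move=> /andP[_ cA] /andP[mA _] /eqP Dk.
have [|C AC] := cube_growth_of_counting_measure _ cA; first by rewrite hD mass_dim_ge0.
rewrite hD in AC.
have Am := mass_growth_of_mass_measure mA.
apply: ae_imp (ae_mass_growth_proj hgamma AC Dk Am) => U Um; apply: mass_measure_gt0.
have -> // : Num.min k%:R (mass_dim A) = mass_dim A - Num.max 0 (mass_dim A - k%:R).
by rewrite minEle maxEle; case: ifP => ?; case: ifP => ?; lra.
Qed.
End Projections.

Unset Implicit Arguments.

Theorem corollaryE (R : realType) (d : nat) (A : set 'rV[R]_d)
    (hD : counting_dim A = mass_dim A) (k : 'I_d.+1)
    (gamma : probability (g_sigma_algebraType (@open (oproj R k))) R)
    (hgamma : Od_invariant gamma) :
  {ae gamma, forall U : oproj R k,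
     mass_dim (proj_image U A) = Num.min (k%:R : R) (mass_dim A)} /\
  (counting_regular A -> mass_regular A -> mass_dim A <> k%:R ->
   {ae gamma, forall U : oproj R k,
      (0 < mass_measure (Num.min (k%:R : R) (mass_dim A)) (proj_image U A))%E}).
Proof.
split; first exact: ae_mass_dim_proj.
exact: ae_mass_measure_proj_gt0.
Qed.
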